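(* For every positive integer $t$, every loopless graph that does not contain a totally odd immersion of $K_t$ is $(700000t + 32000000)$-colorable.
   Context: Graphs are finite and may have parallel edges. A graph is $k$-colorable if its vertices can be colored with $k$ colors so that adjacent vertices receive different colors. A trail $T$ in a graph is a sequence of distinct edges $e_1e_2\cdots e_n$ which can be oriented so that the head of $e_i$ is the tail of $e_{i+1}$ for all $i\in\{1,\dots,n-1\}$. Its ends are the tail of $e_1$ and the head of $e_n$ (which may coincide); vertices may be repeated along a trail; its length is its number of edges. A graph $G$ contains (admits) an immersion of a graph $H$ if there exist injective functions $\varphi_V:V(H)\to V(G)$ and $\varphi_E:E(H)\to\{\text{trails in }G\}$ such that (1) for every $e\in E(H)$ with ends $u,v$, the trail $\varphi_E(e)$ has ends $\varphi_V(u),\varphi_V(v)$, and (2) for all distinct $e_1,e_2\in E(H)$, the trails $\varphi_E(e_1),\varphi_E(e_2)$ are edge-disjoint. The trails $\varphi_E(e)$ are the branch trails. (This is weak immersion: branch trails may pass through branch vertices.) The immersion is totally odd if all branch trails have odd length. $K_n$ is the complete simple graph on $n$ vertices. *)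

(* Defs.v *)
From mathcomp Require Import all_boot.

Set Implicit Arguments.
Unset Strict Implicit.
Unset Printing Implicit Defensive.

(* Finite undirected multigraphs, loops allowed. The order of the two
   components of [ends e] carries no meaning: edges are only used through the
   symmetric relation [joins]. *)
Record mgraph := MGraph {
  vertex : finType;
  edge : finType;
  ends : edge -> vertex * vertex
}.

Definition joins (G : mgraph) (e : edge G) (x y : vertex G) : bool :=
  (ends e == (x, y)) || (ends e == (y, x)).

Definition loopless (G : mgraph) : Prop :=
  forall (e : edge G) (x : vertex G), ~~ joins e x x.

Definition adjacent (G : mgraph) (x y : vertex G) : Prop :=
  exists e : edge G, joins e x y.

Definition colorable (k : nat) (G : mgraph) : Prop :=
  exists c : vertex G -> 'I_k,
    forall x y : vertex G, adjacent x y -> c x <> c y.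

(* The edges of [s], in this order, can be oriented so that each head is the
   next tail, with first tail [x] and last head [y]. *)
Fixpoint traverses (G : mgraph) (x : vertex G) (s : seq (edge G))
    (y : vertex G) : Prop :=
  if s is e :: s' then exists2 z, joins e x z & traverses z s' y else x = y.

(* The two ends are unordered. A short sequence may admit several
   orientations, hence several pairs of ends: two parallel edges between [x]
   and [y] form a closed trail at [x], and also one at [y]. *)
Definition trail_with_ends (G : mgraph) (s : seq (edge G))
    (x y : vertex G) : Prop :=
  [/\ s <> [::], uniq s & traverses x s y \/ traverses y s x].

(* Weak immersion: branch trails may pass through branch vertices. Every edge
   has ends, so [immersion_ends] makes every [phiE e] a trail. *)
Record is_immersion (H G : mgraph) (phiV : vertex H -> vertex G)
    (phiE : edge H -> seq (edge G)) : Prop := IsImmersion {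
  immersion_injV : injective phiV;
  immersion_injE : injective phiE;
  immersion_ends : forall (e : edge H) (u v : vertex H),
    joins e u v -> trail_with_ends (phiE e) (phiV u) (phiV v);
  immersion_disjoint : forall e1 e2 : edge H, e1 <> e2 ->
    forall f : edge G, ~ (f \in phiE e1 /\ f \in phiE e2)
}.

Definition contains_totally_odd_immersion (G H : mgraph) : Prop :=
  exists (phiV : vertex H -> vertex G) (phiE : edge H -> seq (edge G)),
    is_immersion phiV phiE /\ forall e : edge H, odd (size (phiE e)).

(* One edge for each pair i < j. *)
Definition complete_graph (n : nat) : mgraph :=
  @MGraph 'I_n {p : 'I_n * 'I_n | p.1 < p.2} val.

(* Main.v *)
(** Take a cut [A] with as many edges as possible, let B be its crossing edges
and X the others. Flipping the side of any set S shows that B has at least as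
many edges leaving S as X. If both sides of the cut are (d-1)-degenerate in X,
then G is 2d-colourable; otherwise X contains a simple graph of minimum degree
at least d = 175 s, where s = 2000 t.

Such a graph immerses K_s, by the following descent. Deleting few edges makes
all degrees even, and splitting off vertices of small degree gives an even
graph of minimum degree at least 50 s. If no s vertices have pairwise 4 s common
neighbours, then a vertex v can be split off along a matching of the complement
of its neighbourhood, except for a few neighbours whose own neighbourhoods
nearly contain that of v. These are split off in turn; all of them look alike, so
fewer than s vertices are deleted before the process stops, and then every
remaining vertex has kept its degree. Evenness is what allows an unmatched
neighbour to be passed on to a vertex still waiting to be deleted. The smaller
graph being of the same kind, s vertices with pairwise 4 s common neighbours must
appear eventually, and they span an immersion of K_s.

Now let the branch trails of K_s have arbitrary parities. If many paths of
length three in K_s between any two of its vertices are odd, then K_t is found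
greedily. Otherwise the trails are, on a linear part of K_s, almost all of one
parity. If that parity is odd, the greedy argument applies inside this part. If
it is even, an edge of X followed by a trail of B between vertices of the same
side is odd, and the cut inequality together with the edge-disjoint branch trails
gives, by a max-flow argument, quadratically many edge-disjoint trails of this
kind, which serve as odd links in the middle of paths of even trails. *)

Require Import Defs.
From mathcomp Require Import all_boot.
From mathcomp Require Import zify.

Set Implicit Arguments.
Unset Strict Implicit.
Unset Printing Implicit Defensive.

(** * Matchings missing at most one vertex *)

Section Matching.
Variables (V : finType) (C : rel V) (O : {set V}).
Hypotheses (Csym : symmetric C) (Cirr : irreflexive C).

(** A matching is encoded as a total involution, whose fixed points are the unmatched vertices; no
    partial function is needed. *)
Definition matching (mu : {ffun V -> V}) :=
  [forall x, (mu (mu x) == x) && ((mu x != x) ==> (x \in O) && C x (mu x))].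

Definition exposed (mu : {ffun V -> V}) := [set x in O | mu x == x].

Definition unmatch (mu : {ffun V -> V}) x :=
  [ffun z => if (z == x) || (z == mu x) then z else mu z].

Definition rematch (mu : {ffun V -> V}) a b :=
  [ffun z => if z == a then b else if z == b then a else mu z].

Lemma matchingP (mu : {ffun V -> V}) : reflect (involutive mu /\
    forall x, mu x != x -> x \in O /\ C x (mu x)) (matching mu).
Proof.
apply: (iffP forallP) => [H|[H1 H2] x].
  split=> x; first by have /andP[/eqP] := H x.
  by move=> nx; have /andP[_ /implyP/(_ nx)/andP] := H x.
by rewrite H1 eqxx /=; apply/implyP => /H2 [-> ->].
Qed.

Lemma matching_unmatch mu x : matching mu -> matching (unmatch mu x).
Proof.
move=> /matchingP[inv H]; apply/matchingP; split=> z; rewrite !ffunE.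
  case zx: ((z == x) || (z == mu x)); first by rewrite zx.
  have -> : (mu z == x) = (z == mu x) by rewrite -(inj_eq (inv_inj inv)) inv.
  rewrite (inj_eq (inv_inj inv)) orbC zx.
  exact: inv.
by case: ifP => _; [rewrite eqxx|apply: H].
Qed.

Lemma exposed_unmatch mu x : matching mu -> x \in O -> mu x != x ->
  exposed (unmatch mu x) = mu x |: (x |: exposed mu).
Proof.
move=> /matchingP[inv H] xO nx.
have /H[mxO _] : mu (mu x) != mu x by rewrite inv eq_sym.
apply/setP=> z; rewrite !inE ffunE.
case: (eqVneq z (mu x)) => [->|zm] /=; first by rewrite orbT eqxx mxO.
by case: (eqVneq z x) => [->|zx] /=; rewrite ?eqxx ?xO.
Qed.

Lemma matching_rematch mu a b : matching mu -> a \in exposed mu ->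
  b \in exposed mu -> C a b -> matching (rematch mu a b).
Proof.
move=> /matchingP[inv H]; rewrite !inE => /andP[aO /eqP fa] /andP[bO /eqP fb] Cab.
have nab : a != b by apply: contraTneq Cab => ->; rewrite Cirr.
apply/matchingP; split=> z; rewrite !ffunE.
  case: (eqVneq z a) => [->|za]; first by rewrite eq_sym (negPf nab) eqxx.
  case: (eqVneq z b) => [->|zb]; first by rewrite eqxx.
  have -> : (mu z == a) = false by rewrite -fa (inj_eq (inv_inj inv)) (negPf za).
  have -> : (mu z == b) = false by rewrite -fb (inj_eq (inv_inj inv)) (negPf zb).
  exact: inv.
case: (eqVneq z a) => [->|za]; first by [].
case: (eqVneq z b) => [->|zb]; first by rewrite Csym.
exact: H.
Qed.

Lemma exposed_rematch mu a b : matching mu -> a != b ->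
  exposed (rematch mu a b) = (exposed mu :\ a) :\ b.
Proof.
move=> _ nab; apply/setP=> z; rewrite !inE ffunE.
case: (eqVneq z a) => [->|za] /=; first by rewrite (eq_sym b) (negPf nab) andbF.
by case: (eqVneq z b) => [->|zb] //=; rewrite (negPf nab) andbF.
Qed.

(* A matching minimising the sum of b - w x over its exposed vertices x has no
   augmenting path, and an even alternating path from an exposed vertex u only
   reaches vertices of weight at most w u. *)
Lemma near_perfect_matching (w : V -> nat) (M : nat) :
  (forall u, u \in O -> w u <= #|[set x in O | C u x]|) ->
  (forall k, k < M -> #|[set u in O | w u <= k]| <= k) ->
  (forall Y Y' : {set V}, Y \subset O -> Y' \subset O -> M <= #|Y| -> M <= #|Y'| ->
     exists y y', [/\ y \in Y, y' \in Y' & C y y']) ->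
  exists mu, [/\ matching mu, #|exposed mu| <= 1 &
     forall g, g \in exposed mu -> M <= w g].
Proof.
move=> wC wM noY.
have [b wb] : exists b, forall u, u \in O -> w u < b.
  exists #|V|.+1 => u uO.
  by rewrite ltnS (leq_trans (wC u uO)) // max_card.
(* Each exposed vertex costs at least 1 because [b] strictly bounds all weights, so both the number
   of exposed vertices and their low weights are penalised. *)
pose cost (mu : {ffun V -> V}) := \sum_(x in exposed mu) (b - w x).
have id_m : matching [ffun x => x].
  by apply/matchingP; split=> x; rewrite !ffunE // eqxx.
pose mu := [arg min_(mu < [ffun x => x] | matching mu) cost mu].
have [mP mmin] : matching mu /\ forall nu, matching nu -> cost mu <= cost nu.
  by rewrite /mu; case: arg_minnP.
have /matchingP[inv muC] := mP.
have expO x : x \in exposed mu -> x \in O by rewrite inE => /andP[].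
have muO x : mu x != x -> mu x \in O.
  by move=> nx; have [] := muC (mu x); rewrite ?inv 1?eq_sym.
have nbm u x : u \in exposed mu -> x \in O -> C u x -> mu x != x.
  move=> ue xO Cux; apply/negP => fx.
  have xe : x \in exposed mu by rewrite inE xO.
  have nux : u != x by apply: contraTneq Cux => ->; rewrite Cirr.
  have := mmin _ (matching_rematch mP ue xe Cux).
  rewrite /cost exposed_rematch // (big_setD1 u ue) /=.
  rewrite (big_setD1 x) /=; last by rewrite !inE eq_sym nux -(andbC _) xO fx.
  rewrite addnA -[leqRHS]add0n leq_add2r.
  by move: (wb u (expO u ue)); clear; lia.
(* Replacing the matched pair [x], [mu x] by [u], [x] exposes [mu x] instead of [u], which cannot
   lower the cost. *)
have swapw u x : u \in exposed mu -> x \in O -> C u x -> w (mu x) <= w u.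
  move=> ue xO Cux; have nx := nbm _ _ ue xO Cux.
  have nux : u != x by apply: contraTneq Cux => ->; rewrite Cirr.
  have xne : x \notin exposed mu by rewrite inE (negPf nx) andbF.
  have yne : mu x \notin exposed mu.
    by rewrite inE inv eq_sym (negPf nx) andbF.
  have um := matching_unmatch x mP.
  have ue' : u \in exposed (unmatch mu x).
    by rewrite exposed_unmatch // !in_setU1 ue !orbT.
  have xe' : x \in exposed (unmatch mu x).
    by rewrite exposed_unmatch // !in_setU1 eqxx orbT.
  have := mmin _ (matching_rematch um ue' xe' Cux).
  rewrite /cost exposed_rematch // exposed_unmatch //.
  have -> : (mu x |: (x |: exposed mu)) :\ u :\ x = mu x |: (exposed mu :\ u).
    apply/setP=> z; rewrite !in_setD1 !in_setU1 !in_setD1.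
    case: (eqVneq z x) => [->|zx] /=.
      by rewrite (negPf xne) andbF orbF eq_sym (negPf nx).
    case: (eqVneq z u) => [->|zu] //=; rewrite orbF.
    by apply/esym/negbTE; apply: contraNneq yne => <-.
  rewrite (big_setD1 u ue) /= big_setU1 /=; last first.
    by rewrite in_setD1 (negPf yne) andbF.
  rewrite leq_add2r.
  by move: (wb u (expO u ue)) (wb _ (muO _ nx)); clear; lia.
pose X u := [set x in O | C u x].
pose Y u := mu @: X u.
have YO u : u \in exposed mu -> Y u \subset O.
  move=> ue; apply/subsetP => z /imsetP[x xX ->]; move: xX.
  rewrite inE => /andP[xO Cux].
  exact: muO (nbm _ _ ue xO Cux).
have cY u : #|Y u| = #|X u| by rewrite card_imset //; exact: inv_inj.
(* The vertex [u] and the set [Y u] together give more than [w u] vertices of weight at most [w u],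
   which is excluded below [M]. *)
have big u : u \in exposed mu -> M <= w u.
  move=> ue; rewrite leqNgt; apply/negP => /wM.
  apply/negP; rewrite -ltnNge.
  have uY : u \notin Y u.
    apply/negP => /imsetP[x]; rewrite inE => /andP[xO Cux] ux.
    have := nbm _ _ ue xO Cux; move: ue.
    by rewrite inE ux inv eq_sym => /andP[_ ->].
  apply: (@leq_trans #|u |: Y u|).
    by rewrite cardsU1 uY cY add1n ltnS wC // expO.
  apply/subset_leq_card/subsetP => z /setU1P[->|zY].
    by rewrite inE expO //=.
  rewrite inE (subsetP (YO u ue)) //=.
  by have /imsetP[x] := zY; rewrite inE => /andP[xO Cux] ->; apply: swapw.
exists mu; split=> //.
rewrite leqNgt; apply/negP => /card_gt1P[u [u' [ue ue' nuu]]].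
(* With two exposed vertices, both sets [Y u] and [Y u'] have at least [M] elements; an edge between
   them closes an augmenting path. *)
have [y [y' [yY yY' Cyy]]] := noY _ _ (YO _ ue) (YO _ ue')
  (leq_trans (big _ ue) (leq_trans (wC _ (expO _ ue)) (eq_leq (esym (cY u)))))
  (leq_trans (big _ ue') (leq_trans (wC _ (expO _ ue')) (eq_leq (esym (cY u'))))).
have /imsetP[x] := yY; rewrite inE => /andP[xO Cux] Ey.
have /imsetP[x'] := yY'; rewrite inE => /andP[xO' Cux'] Ey'.
have nx := nbm _ _ ue xO Cux; have nx' := nbm _ _ ue' xO' Cux'.
have muinj : injective mu by apply: inv_inj.
have nxx' : x != x' by apply: contraTneq Cyy => exx; rewrite Ey Ey' exx Cirr.
have nux : u != x by apply: contraTneq Cux => ->; rewrite Cirr.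
have nux' : u' != x' by apply: contraTneq Cux' => ->; rewrite Cirr.
have nyy : y != y' by apply: contraTneq Cyy => ->; rewrite Cirr.
have lower nu : matching nu -> exposed nu \subset exposed mu :\ u -> False.
  move=> nuP sE; have := mmin _ nuP; rewrite /cost (big_setD1 u ue) /=.
  rewrite (big_setID (exposed nu)) /= (setIidPr sE) addnCA.
  rewrite -[leqRHS]addn0 leq_add2l.
  by move: (wb u (expO u ue)); clear; lia.
have um := matching_unmatch x mP.
have eum := exposed_unmatch mP xO nx.
have xne : x \notin exposed mu by rewrite inE (negPf nx) andbF.
have xne' : x' \notin exposed mu by rewrite inE (negPf nx') andbF.
have nux2 : u != x' by apply: contraNneq xne' => <-.
have nux2' : u' != x by apply: contraNneq xne => <-.
have yne : y \notin exposed mu by rewrite Ey inE inv eq_sym (negPf nx) andbF.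
have yne' : y' \notin exposed mu by rewrite Ey' inE inv eq_sym (negPf nx') andbF.
have nuy : u != y by apply: contraNneq yne => <-.
have nuy2 : u != y' by apply: contraNneq yne' => <-.
have nuy' : u' != y by apply: contraNneq yne => <-.
have nuy2' : u' != y' by apply: contraNneq yne' => <-.
have m1 : matching (rematch (unmatch mu x) u x).
  by apply: matching_rematch => //; rewrite eum !in_setU1 ?ue ?eqxx ?orbT.
have e1 : exposed (rematch (unmatch mu x) u x) = y |: (exposed mu :\ u).
  rewrite exposed_rematch // eum -Ey; apply/setP=> z.
  rewrite !in_setD1 !in_setU1 !in_setD1.
  case: (eqVneq z x) => [->|zx] /=.
    by rewrite (negPf xne) andbF orbF Ey eq_sym (negPf nx).
  case: (eqVneq z u) => [->|zu] //=.
  by rewrite orbF (negPf nuy).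
case: (eqVneq y' x) => [eyx|nyx].
  (* the augmenting path u - x - y - u' *)
  have ex' : x' = y by rewrite Ey -eyx Ey' inv.
  have Cyu : C y u' by rewrite -ex' Csym.
  apply: (lower (rematch (rematch (unmatch mu x) u x) y u')).
    apply: matching_rematch => //; rewrite e1 !in_setU1 ?eqxx //.
    by rewrite in_setD1 ue' (eq_sym u' u) nuu orbT.
  rewrite exposed_rematch 1?eq_sym // e1; apply/subsetP=> z.
  by rewrite !in_setD1 in_setU1 in_setD1 => /and3P[_ /negPf->].
(* the augmenting path u - x - y - y' - x' - u' *)
have nx'y : x' != y by apply: contraNneq nyx => ex; rewrite Ey' ex Ey inv.
set nu1 := rematch _ _ _ in m1 e1.
have nu1x' : nu1 x' = y'.
  by rewrite !ffunE (eq_sym x') (negPf nux2) (eq_sym x') (negPf nxx') -Ey (negPf nx'y) /=.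
have nx1 : nu1 x' != x' by rewrite nu1x' Ey'.
have m2 := matching_unmatch x' m1.
have e2 := exposed_unmatch m1 xO' nx1; rewrite nu1x' e1 in e2.
have m3 : matching (rematch (unmatch nu1 x') u' x').
  apply: matching_rematch => //; rewrite e2 !in_setU1 ?eqxx ?orbT //.
  by rewrite in_setD1 ue' (eq_sym u' u) nuu !orbT.
have e3 : exposed (rematch (unmatch nu1 x') u' x') =
    y' |: (y |: ((exposed mu :\ u) :\ u')).
  rewrite exposed_rematch // e2; apply/setP=> z.
  rewrite !in_setD1 !in_setU1 !in_setD1.
  case: (eqVneq z x') => [->|zx] /=.
    by rewrite (negPf xne') !andbF orbF Ey' (eq_sym x') (negPf nx') (negPf nx'y).
  case: (eqVneq z u') => [->|zu] //=.
  by rewrite (negPf nuy') (negPf nuy2').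
apply: (lower (rematch (rematch (unmatch nu1 x') u' x') y y')).
  by apply: matching_rematch => //; rewrite e3 !in_setU1 eqxx ?orbT.
rewrite exposed_rematch // e3; apply/subsetP=> z.
rewrite !in_setD1 !in_setU1 !in_setD1 => /and3P[/negPf-> /negPf->] /=.
by case/and3P=> _ -> ->.
Qed.
End Matching.

(** * Simple graphs carried by edge-disjoint trails *)

Lemma traverses_cat (G : mgraph) x s y s' (z : vertex G) :
  traverses x s y -> traverses y s' z -> traverses x (s ++ s') z.
Proof.
elim: s x => [|e s IH] x /=; first by move=> ->.
by case=> u xu uy yz; exists u => //; apply: IH.
Qed.

Definition simple_rel (V : finType) (h : rel V) := symmetric h /\ irreflexive h.
Definition nbhd (V : finType) (h : rel V) x := [set y | h x y].
Definition active (V : finType) (h : rel V) := [set x | nbhd h x != set0].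
Definition even_rel (V : finType) (h : rel V) := forall x, ~~ odd #|nbhd h x|.

Lemma set2_inj (V : finType) (x y z : V) : [set x; y] = [set x; z] -> y = z.
Proof.
move=> E; have : y \in [set x; z] by rewrite -E set22.
have : z \in [set x; y] by rewrite E set22.
by rewrite !inE => /orP[/eqP->|/eqP-> //] /orP[] /eqP.
Qed.

Lemma set2_eqE (V : finType) (x y x' y' : V) : [set x; y] = [set x'; y'] ->
  (x = x' /\ y = y') \/ (x = y' /\ y = x').
Proof.
move=> E; have : x \in [set x'; y'] by rewrite -E set21.
rewrite !inE => /orP[] /eqP xE; [left|right]; split=> //.
  by apply: (@set2_inj _ x'); rewrite -E xE.
by apply: (@set2_inj _ y'); rewrite [RHS]setUC -E xE.
Qed.

Section RelOps.
Variable V : finType.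
Implicit Type h : rel V.

Definition steps (x : V) p := pairmap (fun a b => [set a; b]) x p.

(* Toggling, instead of adding, the edges x -- mu x keeps the graph simple and
   all degrees even. *)
Definition dissolve (h : rel V) (v : V) (mu : V -> V) : rel V :=
  fun x y => [&& x != v, y != v & h x y (+) (h v x && (mu x == y))].

Section Dissolve.
Variables (h : rel V) (v : V) (mu : V -> V).
Hypotheses (hS : simple_rel h) (muK : {in nbhd h v, involutive mu} )
  (muN : forall x, h v x -> h v (mu x)) (mux : forall x, h v x -> mu x != x).

Lemma dissolve_simple : simple_rel (dissolve h v mu).
Proof.
case: hS => hs hi; split=> [x y|x]; rewrite /dissolve.
  have [xv|nx] := eqVneq x v; have [yv|ny] := eqVneq y v => //=.
  rewrite hs; congr (_ (+) _); apply/andP/andP => -[hv /eqP E].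
    by rewrite -E muN // muK ?inE.
  by rewrite -E muN // muK ?inE.
have [xv|nx] := eqVneq x v => //=; rewrite hi /=.
by apply/negP => /andP[hv]; rewrite (negPf (mux hv)).
Qed.

Lemma nbhd_dissolve_v : nbhd (dissolve h v mu) v = set0.
Proof. by apply/setP=> y; rewrite !inE /dissolve eqxx. Qed.

Lemma nbhd_dissolve_out u : u != v -> ~~ h v u ->
  nbhd (dissolve h v mu) u = nbhd h u.
Proof.
move=> nu nh; apply/setP=> y; rewrite !inE /dissolve nu (negPf nh) addbF.
by case: eqVneq => // -> /=; rewrite hS.1 (negPf nh).
Qed.

Lemma nbhd_dissolve_new u : h v u -> ~~ h u (mu u) ->
  nbhd (dissolve h v mu) u = mu u |: (nbhd h u :\ v).
Proof.
move=> hv nh; apply/setP=> y; rewrite !inE /dissolve hv /=.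
have nu : u != v by apply: contraTneq hv => ->; rewrite hS.2.
rewrite nu /= (eq_sym y (mu u)); case: (eqVneq (mu u) y) => [<-|ne] /=.
  rewrite (negPf nh) /= andbT.
  by apply: contraTneq (muN hv) => ->; rewrite hS.2.
by rewrite addbF.
Qed.

Lemma nbhd_dissolve_old u : h v u -> h u (mu u) ->
  nbhd (dissolve h v mu) u = nbhd h u :\ v :\ mu u.
Proof.
move=> hv nh; apply/setP=> y; rewrite !inE /dissolve hv /=.
have nu : u != v by apply: contraTneq hv => ->; rewrite hS.2.
rewrite nu /= (eq_sym y (mu u)); case: (eqVneq (mu u) y) => [<-|ne] /=.
  by rewrite nh andbF.
by rewrite addbF.
Qed.

Lemma card_dissolve_new u : h v u -> ~~ h u (mu u) ->
  #|nbhd (dissolve h v mu) u| = #|nbhd h u|.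
Proof.
move=> hv nh; rewrite nbhd_dissolve_new // cardsU1 !inE (negPf nh) andbF.
by rewrite [RHS](cardsD1 v) inE hS.1 hv.
Qed.

Lemma card_dissolve_old u : h v u -> h u (mu u) ->
  #|nbhd h u| = (#|nbhd (dissolve h v mu) u|).+2.
Proof.
move=> hv nh; rewrite nbhd_dissolve_old // (cardsD1 v) inE hS.1 hv add1n.
rewrite (cardsD1 (mu u) (_ :\ v)) !inE nh andbT.
suff -> : mu u != v by [].
by apply: contraTneq (muN hv) => ->; rewrite hS.2.
Qed.

Lemma dissolve_even : even_rel h -> even_rel (dissolve h v mu).
Proof.
move=> he u; have [->|nu] := eqVneq u v; first by rewrite nbhd_dissolve_v cards0.
have [hv|hv] := boolP (h v u); last by rewrite nbhd_dissolve_out.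
have [hm|hm] := boolP (h u (mu u)); last by rewrite card_dissolve_new.
by have := he u; rewrite (card_dissolve_old hv hm) /= negbK.
Qed.

End Dissolve.

(** Splitting off along a path: its edges are given up in exchange for one edge between its ends. *)
Definition reroute (h : rel V) (a : V) (p : seq V) : rel V := fun x y =>
  ([set x; y] == [set a; last a p]) || h x y && ([set x; y] \notin steps a p).

Lemma steps_rev a p : steps (last a p) (rev (belast a p)) = rev (steps a p).
Proof.
elim/last_ind: p => [|p y IH] //.
rewrite last_rcons belast_rcons lastI rev_rcons /= IH /steps -!cats1 pairmap_cat.
by rewrite /= rev_cat /= setUC.
Qed.

Lemma reroute_simple h a p : a != last a p -> simple_rel h ->
  simple_rel (reroute h a p).
Proof.
move=> ad [hs hi]; split=> [x y|x]; rewrite /reroute.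
  by rewrite (setUC [set x]) hs.
rewrite hi orbF setUid; apply/eqP => E.
have : a \in [set x] by rewrite E set21.
have : last a p \in [set x] by rewrite E set22.
by rewrite !inE => /eqP lx /eqP ax; rewrite lx ax eqxx in ad.
Qed.

End RelOps.

Section Carried.
Variables (G : mgraph) (X : pred (edge G)).
Notation V := (vertex G).
Notation E := (edge G).

(* [own e] is the pair of h-adjacent vertices whose trail uses e; this makes
   the trails of different edges of h disjoint. *)
Record carrier (h : rel V) (T : V -> V -> seq E) (own : E -> {set V}) : Prop :=
  Carrier {
    carrier_trav : forall x y, h x y -> traverses x (T x y) y;
    carrier_uniq : forall x y, h x y -> uniq (T x y);
    carrier_sub : forall x y e, h x y -> e \in T x y -> X e;
    carrier_own : forall x y e, h x y -> e \in T x y -> own e = [set x; y] }.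

Definition carried (h : rel V) := exists T own, carrier h T own.

Lemma carried_sub (h h' : rel V) : subrel h' h -> carried h -> carried h'.
Proof.
move=> hh [T [own [H1 H2 H3 H4]]]; exists T, own; split=> x y *; eauto.
Qed.

(** Each new edge is realised by a path of old edges, whose trails are concatenated. The map [phi]
    sends an old edge to the only new edge using it, so [phi \o own] certifies that the new trails
    are disjoint. *)
Lemma carried_refine (h h' : rel V) (P : V -> V -> seq V) (phi : {set V} -> {set V}) :
  carried h ->
  (forall x y, h' x y -> [/\ path h x (P x y), last x (P x y) = y,
     uniq (steps x (P x y)) & {in steps x (P x y), forall S, phi S = [set x; y]}]) ->
  carried h'.
Proof.
move=> [T [own [H1 H2 H3 H4]]] HP.
pose T' x p := flatten (pairmap T x p).
have T'own x p e : path h x p -> e \in T' x p -> X e /\ own e \in steps x p.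
  elim: p x => [|z p IH] x //= /andP[hxz hp]; rewrite mem_cat => /orP[eT|].
    by rewrite inE (H4 _ _ _ hxz eT) eqxx (H3 _ _ _ hxz eT).
  by move=> /(IH _ hp) [-> eT]; rewrite inE eT orbT.
have T'uniq x p : path h x p -> uniq (steps x p) -> uniq (T' x p).
  elim: p x => [|z p IH] x //= /andP[hxz hp] /andP[ni un].
  rewrite cat_uniq H2 //= IH // andbT; apply/hasPn => e eT'.
  apply: contra ni => eT; rewrite -(H4 _ _ _ hxz eT).
  by have [] := T'own _ _ _ hp eT'.
have T'trav x p : path h x p -> traverses x (T' x p) (last x p).
  elim: p x => [|z p IH] x //= /andP[hxz hp].
  by apply: traverses_cat (H1 _ _ hxz) (IH _ hp).
exists (fun x y => T' x (P x y)), (phi \o own); split=> x y.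
- by move=> /HP [hp lE _ _]; have := T'trav _ _ hp; rewrite lE.
- by move=> /HP [hp _ un _]; apply: T'uniq.
- by move=> e /HP [hp _ _ _] /(T'own _ _ _ hp) [].
- by move=> e /HP [hp _ _ phiE] /(T'own _ _ _ hp) [_ /phiE].
Qed.

Lemma dissolve_carried (h : rel V) (v : V) (mu : V -> V) : simple_rel h ->
  {in nbhd h v, involutive mu} -> (forall x, h v x -> h v (mu x)) ->
  (forall x, h v x -> mu x != x) -> carried h -> carried (dissolve h v mu).
Proof.
case=> hs hi muK muN mux hc.
pose other (S : {set V}) := [pick z in S :\ v].
(* The pair of [v] and [x] is charged to the pair of [x] and [mu x], whose trail runs through [v];
   any other pair is charged to itself. *)
pose phi (S : {set V}) := if v \in S then
  (if other S is Some x then [set x; mu x] else S) else S.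
have phiv x : x != v -> phi [set v; x] = [set x; mu x].
  move=> nx; rewrite /phi set21 /other.
  case: pickP => [z|/(_ x)]; last by rewrite !inE eqxx nx orbT.
  by rewrite !inE => /andP[/negPf-> /= /eqP->].
apply: (@carried_refine h _ (fun x y => if h x y then [:: y] else [:: v; y]) phi) => //.
move=> x y /and3P[nx ny]; case: ifP => hxy /=.
  rewrite hxy; split=> // S; rewrite inE => /eqP ->.
  by rewrite /phi !inE (eq_sym v) (negPf nx) eq_sym (negPf ny).
case/andP=> hvx /eqP E; have hvy : h v y by rewrite -E muN.
rewrite hs hvx hvy; split=> //.
  rewrite /= andbT inE; apply/eqP => /set2_eqE [[xv _]|[xy _]].
    by rewrite xv eqxx in nx.
  by move: (mux _ hvx); rewrite E xy eqxx.
move=> S; rewrite !inE => /orP[] /eqP->.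
  by rewrite setUC phiv // E.
by rewrite phiv // -E muK ?inE // E setUC.
Qed.

Lemma reroute_carried h a p : symmetric h -> path h a p -> uniq (steps a p) ->
  carried h -> carried (reroute h a p).
Proof.
move=> hs hp up hc; set d := last a p.
pose phi (S : {set V}) := if S \in steps a p then [set a; d] else S.
(* Trails are indexed by ordered pairs, so the path is needed in both directions. *)
pose P x y := if (x == a) && (y == d) then p else
  if (x == d) && (y == a) then rev (belast a p) else [:: y].
apply: (@carried_refine h _ P phi) => // x y; rewrite /P => hxy.
case: ifP hxy => [/andP[/eqP-> /eqP->] _|n1 hxy].
  by split=> // S; rewrite /phi => ->.
case: ifP hxy => [/andP[/eqP-> /eqP->] _|n2 hxy].
  rewrite /d rev_path steps_rev rev_uniq; split=> //.
  - by rewrite (eq_path (e' := h)) // => u v; rewrite hs.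
  - by case: (p) => //= z q; rewrite rev_cons last_rcons.
  - by move=> S; rewrite mem_rev /phi => ->; rewrite setUC.
have {hxy}/andP[hxy nxy] : h x y && ([set x; y] \notin steps a p).
  case/orP: hxy => // /eqP /set2_eqE [[xa yd]|[xd ya]].
    by rewrite xa yd !eqxx in n1.
  by rewrite xd ya !eqxx in n2.
rewrite /= hxy; split=> // S; rewrite inE => /eqP ->.
by rewrite /phi (negPf nxy).
Qed.

End Carried.

Lemma set2_eqb (V : finType) (x y a b : V) : ([set x; y] == [set a; b]) =
  (x == a) && (y == b) || (x == b) && (y == a).
Proof.
apply/eqP/idP => [/set2_eqE [] [-> ->]|]; rewrite ?eqxx ?orbT //.
by case/orP=> /andP[/eqP-> /eqP->] //; rewrite setUC.
Qed.

Lemma even_pairing (V : finType) (L : {set V}) : ~~ odd #|L| ->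
  exists mu : V -> V, {in L, forall x, [/\ mu (mu x) = x, mu x \in L & mu x != x]}.
Proof.
elim: {L}_.+1 {-2}L (ltnSn #|L|) => // n IH L; rewrite ltnS => leL ev.
have [->|[x xL]] := set_0Vmem L; first by exists id => x; rewrite inE.
have := cardsD1 x L; rewrite xL => cL.
have [L0|[y yL]] := set_0Vmem (L :\ x).
  by move: ev; rewrite cL L0 cards0.
have := cardsD1 y (L :\ x); rewrite yL => cL'.
have [||mu muP] := IH (L :\ x :\ y); first by lia.
  by move: ev; rewrite cL cL' /= negbK.
have /setD1P[nyx yL'] := yL.
exists (fun z => if z == x then y else if z == y then x else mu z) => z zL.
have [->|nzx] := eqVneq z x; first by rewrite (negPf nyx) eqxx.
have [->|nzy] := eqVneq z y; first by rewrite eqxx xL eq_sym.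
have /muP[E] : z \in L :\ x :\ y by rewrite !inE nzx nzy zL.
by rewrite !inE => /and3P[/negPf-> /negPf-> ->] ->.
Qed.

Lemma fixfree_involution_even (V : finType) (L : {set V}) (mu : V -> V) :
  {in L, forall x, [/\ mu (mu x) = x, mu x \in L & mu x != x]} -> ~~ odd #|L|.
Proof.
elim: {L}_.+1 {-2}L (ltnSn #|L|) => // n IH L; rewrite ltnS => leL muP.
have [->|[x xL]] := set_0Vmem L; first by rewrite cards0.
have [mm mL mx] := muP x xL.
have := cardsD1 x L; rewrite xL => cL.
have := cardsD1 (mu x) (L :\ x); rewrite !inE mL mx => cL'.
rewrite cL cL' /= negbK; apply: IH; first by lia.
move=> z /setD1P[nzm /setD1P[nzx zL]]; have [E mzL mz] := muP z zL.
split=> //; rewrite !inE mzL andbT; apply/andP; split.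
  by apply: contraNneq nzx => ex; rewrite -E ex mm.
by apply: contraNneq nzm => ex; rewrite -E ex.
Qed.

Lemma subset_of_size (V : finType) (S : {set V}) n : n <= #|S| ->
  exists2 S' : {set V}, S' \subset S & #|S'| = n.
Proof.
move=> le; exists [set x in take n (enum S)].
  by apply/subsetP=> x; rewrite inE => /mem_take; rewrite mem_enum.
have /card_uniqP E := take_uniq n (enum_uniq S).
by rewrite cardsE E size_take -cardE; case: ltngtP le.
Qed.

(** The margin [4 * s] suits the construction of a clique: at most [s] common neighbours lie in [S],
    and each of the two ends loses fewer than [s] of the others, so one is always available. *)
Definition dense (V : finType) s (h : rel V) := [exists S : {set V},
  (#|S| == s) && [forall x in S, forall y in S,
    (x != y) ==> (4 * s <= #|nbhd h x :&: nbhd h y|)]].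

Lemma not_dense (V : finType) s (h : rel V) (S : {set V}) : ~~ dense s h ->
  {in S &, forall x y, x != y -> 4 * s <= #|nbhd h x :&: nbhd h y|} -> #|S| < s.
Proof.
move=> nd HS; rewrite ltnNge; apply: contraNN nd => /subset_of_size[S' sS cS].
apply/existsP; exists S'; rewrite cS eqxx /=.
apply/forallP=> x; apply/implyP=> xS; apply/forallP=> y; apply/implyP=> yS.
by apply/implyP; apply: HS; apply: (subsetP sS).
Qed.

Lemma common_nbhd (V : finType) (h : rel V) (B : {set V}) x y :
  #|B| <= #|nbhd h x :&: nbhd h y| + (#|B :\: nbhd h x| + #|B :\: nbhd h y|).
Proof.
rewrite -(cardsID (nbhd h x :&: nbhd h y) B) leq_add //.
  by rewrite subset_leq_card // subsetIr.
by rewrite setDIr (leq_trans (leq_card_setU _ _)).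
Qed.

(** * Vertices whose neighbourhood nearly contains a given set *)

Section Dominators.
Variables (V : finType) (s : nat) (h : rel V) (O A : {set V}).
Hypotheses (s0 : 0 < s) (hS : simple_rel h) (nd : ~~ dense s h)
  (sAO : A \subset O) (cA : 47 * s <= #|A|).

(** The degree of [u] into [A] in the complement graph; it is small when the neighbourhood of [u]
    nearly contains [A]. *)
Let c u := #|A :\: nbhd h u :\ u|.

(** Two such vertices share at least 47 s - 2 (20 s + 1) >= 4 s neighbours in [A]. *)
Lemma few_dominators k : k <= 20 * s -> #|[set u in O | c u <= k]| < s.
Proof.
move=> le; apply: (not_dense nd) => x y; rewrite !inE => /andP[_ cx] /andP[_ cy] nxy.
have := common_nbhd h A x y.
have h1 u : #|A :\: nbhd h u| <= c u + 1.
  by rewrite /c (cardsD1 u (A :\: _)) addnC leq_add2l; case: (_ \in _).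
have := h1 x; have := h1 y; lia.
Qed.

(** Take the largest [m <= s] for which at least [m] vertices have [c u <= m], and let [Z] consist
    of these. By maximality [Z] has exactly [m] elements, and fewer than [k] vertices have
    [c u <= k] when m < k <= 20 s. Hence the weights [c u - #|Z|] outside [Z] meet the sparsity
    hypothesis of [near_perfect_matching]. *)
Lemma dominators_exist : exists Z : {set V}, [/\ Z \subset O, #|Z| < s,
  {in Z, forall u, c u <= #|Z|} &
  forall k, k < 18 * s -> #|[set u in O :\: Z | c u - #|Z| <= k]| <= k].
Proof.
pose Zk k := [set u in O | c u <= k].
have ex0 : exists k, (k <= s) && (k <= #|Zk k|) by exists 0.
have ub k : (k <= s) && (k <= #|Zk k|) -> k <= s by case/andP.
case: (ex_maxnP ex0 ub) => m /andP[ms cm] mmax.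
have monoZ a b : a <= b -> Zk a \subset Zk b.
  by move=> ab; apply/subsetP=> u; rewrite !inE => /andP[-> /leq_trans->].
have small k : k <= 20 * s -> #|Zk k| < s by apply: few_dominators.
have big k : m < k -> k <= 20 * s -> #|Zk k| < k.
  move=> mk ks; case: (leqP k s) => [le|lt]; last exact: ltn_trans (small k ks) lt.
  by rewrite ltnNge; apply/negP => ck; have := mmax k; rewrite le ck => /(_ isT); lia.
have lms : m < s by apply: leq_ltn_trans cm (small _ _); lia.
have cZ : #|Zk m| = m.
  apply/eqP; rewrite eqn_leq cm andbT -ltnS (leq_ltn_trans _ (big m.+1 _ _)) //; last by lia.
  exact/subset_leq_card/monoZ.
exists (Zk m); rewrite cZ; split=> //.
- by apply/subsetP=> u; rewrite inE => /andP[].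
- by move=> u; rewrite inE => /andP[].
move=> k ks; have [->|k0] := posnP k.
  rewrite leqn0 cards_eq0; apply/eqP/setP=> u; rewrite !inE leqn0 subn_eq0.
  by case: (u \in O); rewrite ?andbT ?andbF //= andNb.
have : #|Zk (m + k)| < m + k by apply: big; lia.
rewrite -(cardsID (Zk m) (Zk (m + k))) (setIidPr (monoZ _ _ (leq_addr _ _))) cZ.
rewrite ltn_add2l => /ltnW /(leq_trans _) -> //.
apply: subset_leq_card; apply/subsetP=> u; rewrite !inE leq_subLR.
by case: (u \in O); rewrite //= ?andbT => /andP[-> ->].
Qed.

(** The matching is taken in the complement of [h], with [M] equal to 18 s; removing [Z] from [A]
    lowers a complement degree by at most [#|Z|], which the weights allow for. *)
Lemma near_perfect_outside (Z : {set V}) :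
  (forall k, k < 18 * s -> #|[set u in O :\: Z | c u - #|Z| <= k]| <= k) ->
  exists mu : V -> V, [/\ {in O :\: Z, forall u, mu u \in O :\: Z /\ mu (mu u) = u},
     {in O :\: Z, forall u, ~~ h u (mu u)},
     #|[set u in O :\: Z | mu u == u]| <= 1 &
     {in O :\: Z, forall u, mu u = u -> 18 * s <= #|A :\: Z :\: nbhd h u :\ u|}].
Proof.
move=> hZ; pose C : rel V := fun x y => (x != y) && ~~ h x y.
have Cs : symmetric C by move=> x y; rewrite /C eq_sym hS.1.
have Ci : irreflexive C by move=> x; rewrite /C eqxx.
have cZ u : c u - #|Z| <= #|A :\: Z :\: nbhd h u :\ u|.
  rewrite leq_subLR /c -(cardsID Z) leq_add //.
    by rewrite subset_leq_card // subsetIr.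
  apply/subset_leq_card/subsetP=> z; rewrite !inE.
  by case/and3P=> -> -> /andP[-> ->].
have [|||mu [/matchingP[inv mC] e1 eg]] :=
    @near_perfect_matching V C (O :\: Z) Cs Ci (fun u => c u - #|Z|) (18 * s).
- move=> u uO; apply: leq_trans (cZ u) _; apply/subset_leq_card/subsetP=> z.
  rewrite !inE /C => /and4P[nzu nh nz zA]; rewrite nz (subsetP sAO) //=.
  by rewrite eq_sym nzu.
- exact: hZ.
(* If [h] contained all pairs between [Y] and [Y'], any two vertices of [Y] would have at least 18 s
   - 2 common neighbours, so [Y] would have fewer than [s] elements. *)
- move=> Y Y' sY sY' cY cY'.
  case: (boolP [exists y in Y, exists y' in Y', C y y']) => [|no].
    by case/exists_inP=> y yY /exists_inP[y' yY' Cy]; exists y, y'.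
  suff : #|Y| < s by lia.
  apply: (not_dense nd) => x y xY yY nxy.
  apply: (@leq_trans #|Y' :\ x :\ y|).
    have := cardsD1 x Y'; have := cardsD1 y (Y' :\ x).
    by case: (_ \in _); case: (_ \in _); lia.
  apply/subset_leq_card/subsetP=> z; rewrite !inE => /and3P[nzy nzx zY'].
  have adj u : u \in Y -> z != u -> h u z.
    move=> uY nzu; move: no; rewrite negb_exists_in => /forall_inP/(_ u uY).
    rewrite negb_exists_in => /forall_inP/(_ z zY').
    by rewrite /C eq_sym nzu negbK.
  by rewrite !adj.
exists mu; split.
- move=> u uO; rewrite inv; split=> //.
  have [->//|nu] := eqVneq (mu u) u.
  by have [] := mC (mu u); rewrite ?inv 1?eq_sym.
- move=> u uO; have [->|nu] := eqVneq (mu u) u; first by rewrite hS.2.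
  by have [_ /andP[]] := mC u nu.
- by apply: leq_trans e1; apply/subset_leq_card/subsetP=> u; rewrite !inE.
- move=> u uO muu; apply: leq_trans (cZ u); apply: eg.
  by rewrite inE uO muu /=.
Qed.
End Dominators.

(** * Replacing a path of length three by an edge *)

Section Shortcut.
Variables (V : finType) (h : rel V) (a b c d : V).
Hypotheses (hS : simple_rel h) (ab : h a b) (bc : h b c) (cd : h c d)
  (had : ~~ h a d) (nac : a != c) (nbd : b != d) (nad : a != d).

Let h1 := reroute h a [:: b; c; d].

Let hne x y : h x y -> (x == y = false) * (y == x = false).
Proof.
by move=> hxy; rewrite (eq_sym y); split; apply: contraTF hxy => /eqP->; rewrite hS.2.
Qed.
Let nes := (hne ab, hne bc, hne cd, negPf nac, negPf nbd, negPf nad).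
Let nes' : ((c == a) = false) * ((d == b) = false) * ((d == a) = false).
Proof. by rewrite !(eq_sym _ a) (eq_sym d) !nes. Qed.

Let h1E x y : h1 x y = ((x == a) && (y == d) || (x == d) && (y == a)) ||
  h x y && ~~ [|| (x == a) && (y == b) || (x == b) && (y == a),
     (x == b) && (y == c) || (x == c) && (y == b) |
     (x == c) && (y == d) || (x == d) && (y == c)].
Proof. by rewrite /h1 /reroute /= !inE !set2_eqb. Qed.

Lemma shortcut_steps_uniq : uniq [:: [set a; b]; [set b; c]; [set c; d]].
Proof. by rewrite /= !inE !set2_eqb !eqxx ?nes ?nes'. Qed.

Lemma nbhd_shortcut_b : nbhd h1 b = nbhd h b :\ a :\ c.
Proof.
apply/setP=> y; rewrite !inE h1E !eqxx ?nes ?nes' /=.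
by case: (y == a); case: (y == c); case: (h b y).
Qed.

Lemma nbhd_shortcut_c : nbhd h1 c = nbhd h c :\ b :\ d.
Proof.
apply/setP=> y; rewrite !inE h1E !eqxx ?nes ?nes' /=.
by case: (y == b); case: (y == d); case: (h c y).
Qed.

Lemma nbhd_shortcut_a : nbhd h1 a = d |: (nbhd h a :\ b).
Proof.
apply/setP=> y; rewrite !inE h1E !eqxx ?nes ?nes' /=.
by case: (y == b); case: (y == d); case: (h a y).
Qed.

Lemma nbhd_shortcut_d : nbhd h1 d = a |: (nbhd h d :\ c).
Proof.
apply/setP=> y; rewrite !inE h1E !eqxx ?nes ?nes' /=.
by case: (y == a); case: (y == c); case: (h d y).
Qed.

Lemma nbhd_shortcut_other u : u != a -> u != b -> u != c -> u != d ->
  nbhd h1 u = nbhd h u.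
Proof.
move=> /negPf na /negPf nb /negPf nc /negPf nd.
by apply/setP=> y; rewrite !inE h1E na nb nc nd /= andbT.
Qed.

Lemma card_shortcut_b : #|nbhd h b| = (#|nbhd h1 b|).+2.
Proof.
rewrite nbhd_shortcut_b (cardsD1 a) inE hS.1 ab (cardsD1 c) !inE bc.
by rewrite eq_sym nac.
Qed.

Lemma card_shortcut_c : #|nbhd h c| = (#|nbhd h1 c|).+2.
Proof.
rewrite nbhd_shortcut_c (cardsD1 b) inE hS.1 bc (cardsD1 d) !inE cd.
by rewrite eq_sym nbd.
Qed.

Lemma card_shortcut_a : #|nbhd h1 a| = #|nbhd h a|.
Proof.
by rewrite nbhd_shortcut_a cardsU1 !inE (negPf had) andbF [RHS](cardsD1 b) inE ab.
Qed.

Lemma card_shortcut_d : #|nbhd h1 d| = #|nbhd h d|.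
Proof.
rewrite nbhd_shortcut_d cardsU1 !inE hS.1 (negPf had) andbF.
by rewrite [RHS](cardsD1 c) inE hS.1 cd.
Qed.

Lemma shortcut_even : even_rel h -> even_rel h1.
Proof.
move=> he u; have := he u.
have [->|na] := eqVneq u a; first by rewrite card_shortcut_a.
have [->|nb] := eqVneq u b; first by rewrite card_shortcut_b /= negbK.
have [->|nc] := eqVneq u c; first by rewrite card_shortcut_c /= negbK.
have [->|nd] := eqVneq u d; first by rewrite card_shortcut_d.
by rewrite nbhd_shortcut_other.
Qed.

End Shortcut.

(** * Splitting off a vertex along a partial matching of its neighbourhood *)

Section DissolveMatched.
Variables (G : mgraph) (X : pred (edge G)).
Notation V := (vertex G).

(** By parity the neighbours outside [O] can be paired arbitrarily. A pair inside [O] is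
    non-adjacent, so its vertices exchange [v] for each other and keep their degree; a vertex
    outside [O] has its neighbourhood changed only at [v] and at its partner. *)
Lemma dissolve_matched (h : rel V) (v : V) (O : {set V}) (mu : V -> V) :
  simple_rel h -> carried X h -> even_rel h -> O \subset nbhd h v ->
  {in O, forall u, [/\ mu u \in O, mu (mu u) = u, mu u != u & ~~ h u (mu u)]} ->
  exists h' : rel V, [/\ simple_rel h', carried X h', even_rel h' & [/\
    nbhd h' v = set0,
    (forall u, u != v -> ~~ h v u -> nbhd h' u = nbhd h u),
    {in O, forall u, #|nbhd h' u| = #|nbhd h u| /\
       nbhd h' u \subset mu u |: nbhd h u} &
    {in nbhd h v :\: O, forall u, exists2 z, z \in nbhd h v :\: O &
       nbhd h' u \subset z |: nbhd h u /\
       nbhd h u \subset v |: (z |: nbhd h' u)}]].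
Proof.
move=> hS hc he sO muP.
have evO : ~~ odd #|O|.
  by apply: (@fixfree_involution_even _ _ mu) => x /muP[].
have evL : ~~ odd #|nbhd h v :\: O|.
  have := he v; rewrite -(cardsID O) (setIidPr sO) oddD (negPf evO).
  by [].
have [nu nuP] := even_pairing evL.
pose m x := if x \in O then mu x else nu x.
have mP x : h v x -> [/\ m (m x) = x, h v (m x) & m x != x].
  move=> hvx; rewrite /m; have [xO|xO] := boolP (x \in O).
    have [mO mm mx _] := muP x xO; rewrite mO mm; split=> //.
    by have := subsetP sO _ mO; rewrite inE.
  have /nuP[nn nL nx] : x \in nbhd h v :\: O by rewrite !inE xO hvx.
  by move: nL; rewrite !inE => /andP[/negPf-> ->].
have mK : {in nbhd h v, involutive m}.
  by move=> x; rewrite inE => /mP[].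
have mN x : h v x -> h v (m x) by move=> /mP[].
have mx x : h v x -> m x != x by move=> /mP[].
exists (dissolve h v m); split.
- by apply: dissolve_simple.
- by apply: dissolve_carried.
- by apply: dissolve_even.
split; first by apply: nbhd_dissolve_v.
- by move=> u nu' nh; apply: nbhd_dissolve_out.
- move=> u uO; have hvu : h v u by have := subsetP sO _ uO; rewrite inE.
  have [_ _ _ nh] := muP u uO.
  have mE : m u = mu u by rewrite /m uO.
  rewrite -mE in nh.
  rewrite card_dissolve_new // nbhd_dissolve_new // mE; split=> //.
  by rewrite setUS // subsetDl.
move=> u uL; have := uL; rewrite !inE => /andP[uO hvu].
have mE : m u = nu u by rewrite /m (negPf uO).
have [_ nuL _] := nuP u uL.
exists (nu u) => //.
have [hm|hm] := boolP (h u (m u)).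
  rewrite nbhd_dissolve_old // mE; split.
    by apply/subsetP=> z; rewrite !inE => /and3P[_ _ ->]; rewrite orbT.
  by apply/subsetP=> z; rewrite !inE => ->; case: (z == v); case: (z == nu u).
rewrite nbhd_dissolve_new // mE; split; first by rewrite setUS // subsetDl.
by apply/subsetP=> z; rewrite !inE => ->; case: (z == v); case: (z == nu u).
Qed.

End DissolveMatched.

(** * Deleting a cluster of vertices *)

Lemma cardsD_trans (V : finType) (B C D : {set V}) :
  #|B :\: D| <= #|B :\: C| + #|C :\: D|.
Proof.
apply: leq_trans (leq_card_setU _ _); apply/subset_leq_card/subsetP=> x.
by rewrite !inE => /andP[-> ->]; case: (x \in C).
Qed.

Lemma cardsU1_le (V : finType) (x : V) (B : {set V}) : #|x |: B| <= #|B|.+1.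
Proof. by rewrite cardsU1; case: (_ \notin _). Qed.

Section Cluster.
Variables (G : mgraph) (X : pred (edge G)) (s : nat).
Notation V := (vertex G).
Variables (h0 : rel V) (v0 : V).
Let A := nbhd h0 v0.
Hypotheses (s0 : 0 < s) (cA : 50 * s <= #|A|).
Hypothesis no_dense : forall h : rel V, simple_rel h -> carried X h -> ~~ dense s h.
Hypotheses (h0S : simple_rel h0) (h0C : carried X h0).

(* R is the set of deleted vertices, Q that of vertices still to be deleted. *)
Record cluster (h : rel V) (R Q : {set V}) : Prop := Cluster {
  cl_simple : simple_rel h;
  cl_carried : carried X h;
  cl_even : even_rel h;
  cl_disjoint : [disjoint R & Q];
  cl_removed : {in R, forall x, nbhd h x = set0};
  cl_deg : forall u, u \notin R :|: Q -> #|nbhd h u| = #|nbhd h0 u|;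
  cl_gain : forall u, #|nbhd h u :\: nbhd h0 u| <= 2 * #|R|;
  cl_Q : {in Q, forall q, #|A :\: (R :|: Q) :\: nbhd h q| <= #|R| + #|R :|: Q|};
  cl_R : {in R, forall u, #|A :\: (R :|: Q) :\: nbhd h0 u| <= 3 * #|R| + #|R :|: Q|}
}.

(** In [h0] each vertex of [K] misses at most 4 |K| < 8 s of the at least 48 s vertices of [A]
    outside [K], so any two have 4 s common neighbours. A bound of 2 s thus improves to [s], which
    leaves room for adding up to [s] vertices at a time. *)
Lemma cluster_small h R Q : cluster h R Q -> #|R :|: Q| < 2 * s -> #|R :|: Q| < s.
Proof.
move=> cl lt; set K := R :|: Q in lt *.
have RK : #|R| <= #|K| by rewrite subset_leq_card // subsetUl.
have near u : u \in K -> #|A :\: K :\: nbhd h0 u| <= 3 * #|R| + #|K|.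
  case/setUP=> [/(cl_R cl)//|/(cl_Q cl)].
  have := cl_gain cl u; have := cardsD_trans (A :\: K) (nbhd h u) (nbhd h0 u).
  by rewrite -/K; lia.
apply: (not_dense (no_dense h0S h0C)) => x y xK yK _.
have := common_nbhd h0 (A :\: K) x y; have := near x xK; have := near y yK.
have := cardsID K A; have : #|A :&: K| <= #|K| by rewrite subset_leq_card ?subsetIr.
lia.
Qed.

(** The waiting vertex [v] is dissolved along non-adjacent pairs of neighbours outside [K]. The set
    [Z] of neighbours that nearly dominate [A] is kept out of the matching and joins the queue; as
    [Z] has fewer than [s] elements, [cluster_small] applies afterwards. *)
Lemma cluster_step h R Q v : cluster h R Q -> v \in Q -> #|R :|: Q| < s ->
  exists h' Q', cluster h' (v |: R) Q' /\ #|(v |: R) :|: Q'| < s.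
Proof.
move=> cl vQ cK; have hS := cl_simple cl.
have hs : symmetric h := hS.1.
set K := R :|: Q in cK *.
have RK : #|R| <= #|K| by rewrite subset_leq_card // subsetUl.
have vK : v \in K by rewrite inE vQ orbT.
have vR : v \notin R by apply/negP => /(disjointFr (cl_disjoint cl)); rewrite vQ.
have notR x y : h x y -> y \notin R.
  move=> hxy; apply/negP => /(cl_removed cl)/setP/(_ x).
  by rewrite !inE hs hxy.
pose O := nbhd h v :\: K; pose AO := A :&: O.
have AOE : AO = (A :\: K) :&: nbhd h v.
  by apply/setP=> z; rewrite !inE; case: (h v z); rewrite ?andbF ?andbT // andbC.
(* From the 50 s vertices of [A], fewer than [s] lie in [K] and fewer than 2 s others are missed by
   [v]. *)
have cAO : 47 * s <= #|AO|.
  have := cl_Q cl vQ; rewrite -/K; have := cardsID (nbhd h v) (A :\: K).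
  rewrite -AOE; have := cardsID K A.
  have : #|A :&: K| <= #|K| by rewrite subset_leq_card ?subsetIr.
  by clear -cA cK RK s0; lia.
have nd := no_dense hS (cl_carried cl).
have sAO : AO \subset O by apply: subsetIr.
have [Z [sZ cZ Zc Zk]] := dominators_exist s0 nd sAO cAO.
have [mu [muO nmu e1 eg]] := near_perfect_outside s0 hS nd sAO cAO Zk.
pose O' := O :\: Z; pose Q' := (Q :\ v) :|: Z; pose R' := v |: R.
pose K' := R' :|: Q'.
have K'E : K' = K :|: Z.
  apply/setP=> z; rewrite !inE; case: (eqVneq z v) => [->|_] /=; last by rewrite orbA.
  by rewrite vQ orbT.
have cK' : #|K'| = #|K| + #|Z|.
  rewrite K'E cardsU (_ : K :&: Z = set0) ?cards0 ?subn0 //.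
  apply/setP=> z; rewrite in_setI in_set0; apply/negP => /andP[zK /(subsetP sZ)].
  by case/setDP=> _; rewrite zK.
have cR' : #|R'| = #|R|.+1 by rewrite cardsU1 vR.
have sKK' : A :\: K' \subset A :\: K by rewrite K'E setDS // subsetUl.
have Q'K' q : q \in Q' -> q \in K' by apply: (subsetP (subsetUr _ _)).
have O'K' x : x \in O' -> x \notin K'.
  by case/setDP=> /setDP[_ xK] xZ; rewrite K'E in_setU negb_or xK.
have O'N x : x \in O' -> h v x by case/setDP=> /setDP[]; rewrite inE.
have NO' x : h v x -> x \notin O' -> x \in Q'.
  move=> hvx nO; have xR := notR _ _ hvx; rewrite in_setU in_setD1.
  case xZ: (x \in Z); rewrite ?orbT //= orbF; apply/andP; split.
    by apply: contraTneq hvx => ->; rewrite hS.2.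
  apply: contraR nO => xQ; rewrite in_setD xZ /= in_setD in_setU negb_or xR xQ.
  by rewrite inE hvx.
(* A vertex of [Z] misses at most what [v] misses, plus the at most [#|Z|] vertices counted by [c];
   the growth of [K] to [K'] pays for the latter. *)
have bound q : q \in Q' -> #|A :\: K' :\: nbhd h q| <= #|R| + #|K'|.
  case/setUP=> [/setD1P[_ qQ]|qZ].
    apply: leq_trans (subset_leq_card (setSD _ sKK')) _.
    by apply: leq_trans (cl_Q cl qQ) _; rewrite cK' -/K addnA leq_addr.
  apply: leq_trans (_ : #|A :\: K :\: nbhd h v| + #|AO :\: nbhd h q :\ q| <= _).
    apply: leq_trans (leq_card_setU _ _); apply/subset_leq_card/subsetP=> z.
    case/setDP=> /setDP[zA zK'] zq; move: zK'; rewrite K'E in_setU negb_or.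
    case/andP=> zK zZ; rewrite AOE in_setU !in_setD in_set1 in_setI in_setD zq zA zK /=.
    by case: (z \in nbhd h v) => //=; rewrite andbT; apply: contraNneq zZ => ->.
  by rewrite cK' addnA leq_add // ?(cl_Q cl vQ) ?Zc.
(* If g stays exposed, parity provides a neighbour q of v in Q', and the path
   g - v - q - d is first replaced by an edge g d. *)
have [h1 [O1 [h1S h1C h1e [P1 P2 P0 [P3 P4 P5 [P6 P7]]]]]] :
  exists (h1 : rel V) (O1 : {set V}), [/\ simple_rel h1, carried X h1, even_rel h1 &
   [/\ O1 \subset nbhd h1 v, nbhd h1 v :\: O1 \subset Q', O1 \subset O' &
   [/\ {in O1, forall u, [/\ mu u \in O1, mu (mu u) = u, mu u != u & ~~ h1 u (mu u)]},
     forall u, u \notin K' -> #|nbhd h1 u| = #|nbhd h u|,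
     forall u, #|nbhd h1 u :\: nbhd h u| <= 1 &
     {in Q', forall q, #|A :\: K' :\: nbhd h1 q| <= (#|R| + #|K'|).+1} /\
     {in R, forall x, nbhd h1 x = set0}]]].
  have fixO u : u \in O' -> u \notin [set u in O' | mu u == u] -> mu u != u.
    by move=> uO; rewrite inE uO.
  have [X0|[g gX]] := set_0Vmem [set u in O' | mu u == u].
    exists h, O'; split=> //; [exact: cl_carried cl|exact: cl_even cl|].
    split=> //.
    - by apply/subsetP=> u uO; rewrite inE O'N.
    - by apply/subsetP=> u /setDP[]; rewrite inE; apply: NO'.
    split=> //.
    - move=> u uO; have [muO' ->] := muO u uO; split=> //; last exact: nmu.
      by apply: fixO; rewrite // X0 inE.
    - by move=> u; rewrite setDv cards0.
    by split=> [q /bound/leqW//|]; apply: cl_removed cl.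
  have XE u : u \in O' -> u != g -> mu u != u.
    move=> uO nug; apply: fixO => //; apply: contra nug => uX.
    by rewrite (card_le1_eqP e1 _ _ uX gX).
  have /andP[gO /eqP mug] : (g \in O') && (mu g == g) by move: gX; rewrite inE.
  have muP : {in O' :\ g, forall u, [/\ mu (mu u) = u, mu u \in O' :\ g & mu u != u]}.
    move=> u /setD1P[nug uO]; have [muO' mm] := muO u uO; split=> //; last exact: XE.
    rewrite in_setD1 muO' andbT; apply: contraNneq nug => mg.
    by rewrite -mm mg mug.
  have sO'N : O' \subset nbhd h v.
    by apply/subsetP=> u uO; rewrite inE O'N.
  have [q qL] : exists q, q \in nbhd h v :\: O'.
    apply/set0Pn; rewrite -card_gt0 lt0n; apply/eqP => L0.
    have := cl_even cl v; rewrite -(cardsID O') (setIidPr sO'N) L0 addn0.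
    by rewrite (cardsD1 g) gO /= (fixfree_involution_even muP).
  have hvq : h v q by have /setDP[] := qL; rewrite inE.
  have qO : q \notin O' by have /setDP[] := qL.
  have qQ' := NO' _ hvq qO.
  (* The exposed vertex [g] has at least 18 s non-neighbours in this set, and [q] misses fewer than
     3 s of them. *)
  have [d dP] : exists d, d \in (AO :\: Z :\: nbhd h g :\ g) :&: nbhd h q.
    apply/set0Pn; rewrite -card_gt0.
    have /= := eg g gO mug; rewrite -(cardsID (nbhd h q)).
    have : #|(AO :\: Z :\: nbhd h g :\ g) :\: nbhd h q| <= #|A :\: K' :\: nbhd h q|.
      apply/subset_leq_card/setSD/subsetP=> z; rewrite AOE K'E.
      case/setD1P=> _ /setDP[/setDP[/setIP[/setDP[zA zK] _] zZ] _].
      by rewrite in_setD zA in_setU negb_or zK zZ.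
    have := bound q qQ'; rewrite cK'; clear -cK RK cZ s0; lia.
  have /setIP[/setD1P[ndg /setDP[/setDP[/setIP[_ dO] dZ]]]] := dP.
  rewrite !inE => nhgd hqd; have {}dO : d \in O' by rewrite in_setD dZ.
  have hvd := O'N _ dO; have hvg := O'N _ gO.
  have hgv : h g v by rewrite hs.
  have ngq : g != q by apply: contraNneq qO => <-.
  have nvd : v != d by apply: contraTneq hvd => ->; rewrite hS.2.
  have ngd : g != d by rewrite eq_sym.
  pose h1 := reroute h g [:: v; q; d].
  have h1S : simple_rel h1 by apply: reroute_simple.
  have other u : u != g -> u != v -> u != q -> u != d -> nbhd h1 u = nbhd h u.
    by apply: nbhd_shortcut_other.
  have Nv : nbhd h1 v = nbhd h v :\ g :\ q by apply: nbhd_shortcut_b.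
  have Nq : nbhd h1 q = nbhd h q :\ v :\ d by apply: nbhd_shortcut_c.
  have Ng : nbhd h1 g = d |: (nbhd h g :\ v) by apply: nbhd_shortcut_a.
  have Nd : nbhd h1 d = g |: (nbhd h d :\ q) by apply: nbhd_shortcut_d.
  (* The shortcut detaches both [g] and [q] from [v], so only the matched vertices of [O'] remain to
     be handled by [mu]. *)
  exists h1, (O' :\ g); split=> //.
  - apply: reroute_carried; rewrite ?hs //; first by rewrite /= hgv hvq hqd.
      by apply: (@shortcut_steps_uniq _ h).
    exact: cl_carried cl.
  - by apply: (@shortcut_even _ h) => //; apply: cl_even cl.
  split.
  - rewrite Nv; apply/subsetP=> u /setD1P[nug uO]; rewrite !in_setD1 nug inE O'N // andbT.
    by rewrite (contraNneq _ qO) // => <-.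
  - rewrite Nv; apply/subsetP=> u /setDP[/setD1P[_ /setD1P[nug]]].
    by rewrite inE in_setD1 nug; apply: NO'.
  - exact: subsetDl.
  split.
  - move=> u uO; have [mm mO mne] := muP u uO; split=> //.
    have /setD1P[nug uO'] := uO; have /setD1P[nmg _] := mO.
    rewrite /h1 /reroute /= (negPf (nmu u uO')) orbF set2_eqb.
    by rewrite (negPf nug) (negPf nmg) andbF.
  - move=> u uK'.
    have nuv : u != v by apply: contraNneq uK' => ->; rewrite K'E in_setU vK.
    have nuq : u != q by apply: contraNneq uK' => ->; apply: Q'K'.
    have [->|nug] := eqVneq u g; first by apply: card_shortcut_a.
    have [->|nud] := eqVneq u d; first by apply: card_shortcut_d.
    by rewrite other.
  - have le1 (x y z : V) (N : {set V}) : #|(x |: (N :\ y)) :\: N| <= 1.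
      rewrite -(cards1 x); apply/subset_leq_card/subsetP=> w.
      by case/setDP=> /setU1P[->|/setD1P[_ ->]] //; rewrite set11.
    have le0 (x y : V) (N : {set V}) : #|(N :\ x :\ y) :\: N| <= 1.
      rewrite (_ : _ :\: N = set0) ?cards0 //; apply/setP=> w; rewrite in_set0.
      by apply/negP => /setDP[/setD1P[_ /setD1P[_ ->]]].
    move=> u; have [->|nuv] := eqVneq u v; first by rewrite Nv.
    have [->|nuq] := eqVneq u q; first by rewrite Nq.
    have [->|nug] := eqVneq u g; first by rewrite Ng le1.
    have [->|nud] := eqVneq u d; first by rewrite Nd le1.
    by rewrite other // setDv cards0.
  split.
  - move=> p pQ'; have pK' := Q'K' _ pQ'; apply: leq_trans (_ : _ <= (#|A :\: K' :\: nbhd h p|).+1) _; last first.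
      by rewrite ltnS bound.
    have npv : p != v.
      case/setUP: pQ' => [/setD1P[]//|/(subsetP sZ)/setDP[_]].
      by apply: contraNneq => ->.
    (* Among the waiting vertices only [q] is affected, and outside [K'] it loses just [d], since
       [v] lies in [K']. *)
    have [->|npq] := eqVneq p q; last first.
      rewrite other //; first by apply: contraTneq pK' => ->; apply: O'K'.
      by apply: contraTneq pK' => ->; apply: O'K'.
    apply: leq_trans (cardsU1_le d _); apply/subset_leq_card/subsetP=> w.
    case/setDP=> wA; rewrite Nq !in_setD1 in_setU1 in_setD wA andbT.
    have -> : w != v; last by case: (w == d).
    by apply: contraTneq wA => ->; rewrite in_setD K'E in_setU vK.
  move=> x xR; rewrite other ?(cl_removed cl) //.
  - by apply: contraTneq xR => ->; apply: notR hvg.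
  - by apply: contraTneq xR => ->.
  - by apply: contraTneq xR => ->; apply: notR hvq.
  - by apply: contraTneq xR => ->; apply: notR hvd.
have [h' [h'S h'C h'e [Nv Nout NO NL]]] := dissolve_matched h1S h1C h1e P1 P3.
have cl' : cluster h' R' Q'.
  have NLQ u : h1 v u -> u \notin O1 -> u \in nbhd h1 v :\: O1.
    by move=> hvu uO; rewrite !inE uO.
  split=> //.
  - rewrite disjoint_sym disjoints_subset; apply/subsetP=> z; rewrite !inE negb_or.
    case/orP=> [/andP[-> zQ]|zZ] /=.
      by apply/negP => /(disjointFr (cl_disjoint cl)); rewrite zQ.
    have := subsetP sZ z zZ; rewrite !inE negb_or => /andP[/andP[-> zQ] _].
    by rewrite andbT; apply: contraNneq zQ => ->.
  - move=> x /setU1P[->//|xR]; have N1 := P7 x xR.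
    rewrite Nout //; first by apply: contraNneq vR => <-.
    by apply/negP; rewrite h1S.1 => hxv; move/setP/(_ v): N1; rewrite !inE hxv.
  - move=> u; rewrite -/K' => uK'.
    have uK : u \notin K by apply: contra uK'; rewrite K'E (in_setU u K) => ->.
    rewrite -(cl_deg cl uK) -(P4 u uK').
    have nuv : u != v by apply: contraNneq uK => ->.
    have [hvu|nh] := boolP (h1 v u); last by rewrite Nout.
    have [uO1|uO1] := boolP (u \in O1); first by have [] := NO u uO1.
    by have := Q'K' _ (subsetP P2 _ (NLQ _ hvu uO1)); rewrite (negPf uK').
  (* At most two neighbours are gained per removed vertex: one from the shortcut and one from
     dissolving [v]. *)
  - move=> u; rewrite cR'.
    have [z Hz] : exists z, nbhd h' u \subset z |: nbhd h1 u.
      have [->|nuv] := eqVneq u v; first by exists v; rewrite Nv sub0set.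
      have [hvu|nh] := boolP (h1 v u); last by exists u; rewrite Nout // subsetUr.
      have [uO1|uO1] := boolP (u \in O1); first by exists (mu u); have [] := NO u uO1.
      by have [z _ []] := NL _ (NLQ _ hvu uO1); exists z.
    have := cl_gain cl u; have := P5 u.
    have := cardsD_trans (nbhd h1 u) (nbhd h u) (nbhd h0 u).
    have : #|nbhd h' u :\: nbhd h0 u| <= (#|nbhd h1 u :\: nbhd h0 u|).+1.
      apply: leq_trans (cardsU1_le z _); apply/subset_leq_card/subsetP=> w.
      case/setDP=> /(subsetP Hz) /setU1P[->|wN] wN0; rewrite in_setU1 ?eqxx //.
      by rewrite in_setD wN0 wN orbT.
    by clear; lia.
  - move=> q qQ'; rewrite -/K' cR'; apply: leq_trans (P6 q qQ').
    have qv : q != v.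
      case/setUP: qQ' => [/setD1P[]//|/(subsetP sZ)].
      by apply: contraTneq => ->; rewrite !inE vQ orbT.
    have [hvq|nh] := boolP (h1 v q); last by rewrite Nout.
    have qO1 : q \notin O1.
      by apply/negP => /(subsetP P0)/O'K'; rewrite Q'K'.
    (* The partner [z] of a waiting vertex lies in [K'], as does [v], so dissolving costs it no
       neighbour outside [K']. *)
    have [z /(subsetP P2)/Q'K' zK' [_ sub]] := NL _ (NLQ _ hvq qO1).
    apply/subset_leq_card/subsetP=> w; rewrite !(in_setD _ (nbhd _ _)).
    move=> /andP[nw wA]; rewrite wA andbT; apply: contra nw => /(subsetP sub).
    have wK' : w \notin K' by move: wA; rewrite inE => /andP[].
    case/setU1P=> [wv|/setU1P[wz|//]]; last by rewrite wz zK' in wK'.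
    by rewrite wv K'E inE vK in wK'.
  - move=> u uR'; rewrite -/K' cR'.
    apply: leq_trans (subset_leq_card (setSD _ sKK')) _.
    (* When [v] moves from [Q] to [R], its bound for [h] is converted to one for [h0] by adding the
       gain of at most 2 |R|; this is the source of the coefficient 3 in [cl_R]. *)
    case/setU1P: uR' => [->|/(cl_R cl)]; last by rewrite -/K cK'; clear; lia.
    have := cl_Q cl vQ; have := cl_gain cl v.
    have := cardsD_trans (A :\: K) (nbhd h v) (nbhd h0 v).
    by rewrite -/K cK'; clear; lia.
exists h', Q'; split=> //; apply: (cluster_small cl').
by rewrite -/K' cK'; clear -cK cZ; lia.
Qed.
End Cluster.

(** * Descent on even graphs of large minimum degree *)

Section Hub.
Variables (G : mgraph) (X : pred (edge G)) (s : nat).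
Notation V := (vertex G).
Hypothesis s1 : 1 < s.
Let s0 : 0 < s := ltnW s1.
Hypothesis no_dense : forall h : rel V, simple_rel h -> carried X h -> ~~ dense s h.

(** Each step enlarges [R], which stays smaller than [s], so the queue empties. *)
Lemma cluster_run (h0 : rel V) v0 h R Q : simple_rel h0 -> carried X h0 ->
  50 * s <= #|nbhd h0 v0| -> cluster X h0 v0 h R Q -> #|R :|: Q| < s ->
  exists h' R', [/\ cluster X h0 v0 h' R' set0, R \subset R' & #|R'| < s].
Proof.
move=> h0S h0C cA; have [n] := ubnP (s - #|R|).
elim: n h R Q => // n IH h R Q; rewrite ltnS => le cl lt.
have [Q0|[v vQ]] := set_0Vmem Q.
  by exists h, R; rewrite Q0 setU0 in cl lt; split.
have [h' [Q' [cl' lt']]] := cluster_step s0 cA no_dense h0S h0C cl vQ lt.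
have vR : v \notin R by apply/negP => /(disjointFr (cl_disjoint cl)); rewrite vQ.
have Rs : #|R| < s by apply: leq_ltn_trans (subset_leq_card (subsetUl R Q)) lt.
have [|h'' [R'' [cl'' sR lt'']]] := IH _ _ _ _ cl' lt'.
  by rewrite cardsU1 vR; move: le Rs; clear; lia.
by exists h'', R''; split=> //; apply: subset_trans sR; apply: subsetUr.
Qed.

(** Once the queue started by [v] is empty, every remaining vertex has its old degree, so the
    smaller graph satisfies the same hypotheses and is edgeless by induction. Then all neighbours of
    [v] have been deleted, although fewer than [s] vertices were. *)
Lemma no_even_min_degree (h : rel V) : simple_rel h -> carried X h -> even_rel h ->
  (forall x, nbhd h x != set0 -> 50 * s <= #|nbhd h x|) -> active h = set0.
Proof.
have [n] := ubnP #|active h|.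
elim: n h => // n IH h; rewrite ltnS => le hS hC he hD.
apply/eqP; apply/negPn/negP => /set0Pn[v]; rewrite inE => /hD cA.
have cl0 : cluster X h v h set0 [set v].
  split=> //.
  - by rewrite disjoints_subset sub0set.
  - by move=> x; rewrite inE.
  - by move=> u; rewrite setDv cards0.
  - by move=> u /set1P->; rewrite setDDl setUC -setDDl setDv set0D cards0.
  - by move=> x; rewrite inE.
have lt0 : #|set0 :|: [set v]| < s.
  by rewrite set0U cards1.
have [h1 [Q1 [cl1 lt1]]] := cluster_step s0 cA no_dense hS hC cl0 (set11 v) lt0.
have [h2 [R [cl2 sR cR]]] := cluster_run hS hC cA cl1 lt1.
have vR : v \in R by apply: (subsetP sR); rewrite !inE eqxx.
have deg2 x : x \notin R -> #|nbhd h2 x| = #|nbhd h x|.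
  by move=> xR; apply: (cl_deg cl2); rewrite setU0.
have act2 x : (x \in active h2) = (x \notin R) && (x \in active h).
  rewrite !inE; have [xR|xR] := boolP (x \in R).
    by rewrite (cl_removed cl2 xR) eqxx.
  by rewrite -!card_gt0 deg2.
have vact : v \in active h by rewrite inE -card_gt0; move: cA s0; clear; lia.
have E2 : active h2 = set0.
  apply: IH; [|exact: cl_simple cl2|exact: cl_carried cl2|exact: cl_even cl2|].
    apply: leq_trans le; apply/proper_card/properP; split.
      by apply/subsetP=> x; rewrite act2 => /andP[].
    by exists v; rewrite // act2 vR.
  move=> x xa; have := act2 x; rewrite inE xa => /esym/andP[xR].
  by rewrite inE deg2 //; apply: hD.
have : #|nbhd h v| <= #|R|.
  apply/subset_leq_card/subsetP=> x; rewrite inE => hvx.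
  have := act2 x; rewrite E2 in_set0 => /esym/negbT.
  rewrite negb_and negbK => /orP[//|]; rewrite inE negbK => /eqP/setP/(_ v).
  by rewrite !inE hS.1 hvx.
by move: cA cR s0; clear; lia.
Qed.
End Hub.

(** * Even subgraphs of large minimum degree *)

Section EvenSub.
Variables (V : finType) (a : rel V).
Hypothesis aS : simple_rel a.
Implicit Types (F D : {set {set V}}).

Let edges : {set {set V}} := [set P | [exists x, exists y, a x y && (P == [set x; y])]].
Let rel_of F : rel V := fun x y => (x != y) && ([set x; y] \in F).
Let deg F x := \sum_(P in F) (x \in P).

Let edgesE x y : ([set x; y] \in edges) = a x y.
Proof.
rewrite inE; apply/existsP/idP => [[u /existsP[v /andP[auv /eqP/set2_eqE]]]|axy].
  by case=> -[-> ->] //; rewrite aS.1.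
by exists x; apply/existsP; exists y; rewrite axy eqxx.
Qed.

Let edges_card P : P \in edges -> #|P| = 2.
Proof.
rewrite inE => /existsP[u /existsP[v /andP[auv /eqP->]]].
by rewrite cards2; case: eqVneq auv => // ->; rewrite aS.2.
Qed.

Let rel_of_simple F : simple_rel (rel_of F).
Proof.
by split=> [x y|x]; rewrite /rel_of ?eqxx // eq_sym (setUC [set x]).
Qed.

Let nbhd_rel_of F x : F \subset edges -> #|nbhd (rel_of F) x| = deg F x.
Proof.
move=> sF; rewrite /deg.
rewrite (eq_bigr (fun P : {set V} => if x \in P then 1 else 0)); last first.
  by move=> P _; case: (_ \in _).
rewrite -big_mkcondr /= sum1_card.
rewrite -(@card_in_imset _ _ (fun y => [set x; y]) (nbhd _ _)); last first.
  by move=> y z _ _; apply: set2_inj.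
apply: eq_card => P; apply/imsetP/andP => [[y]|[PF xP]].
  by rewrite inE => /andP[_ yF] ->; rewrite set21.
have := subsetP sF P PF; rewrite inE => /existsP[u /existsP[v /andP[auv /eqP E]]].
have nuv : u != v by apply: contraTneq auv => ->; rewrite aS.2.
move: xP PF; rewrite E !inE => /orP[] /eqP-> PF.
  by exists v => //; rewrite inE /rel_of nuv.
by exists u; rewrite 1?setUC // inE /rel_of eq_sym nuv setUC.
Qed.

Let sum_deg F : F \subset edges -> \sum_x deg F x = 2 * #|F|.
Proof.
move=> sF; rewrite exchange_big /= (eq_bigr (fun _ => 2)) => [|P PF].
  by rewrite sum_nat_const mulnC.
rewrite -(edges_card (subsetP sF P PF)) -sum1_card [RHS]big_mkcond /=.
by apply: eq_bigr => x _; case: (x \in P).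
Qed.

Let par F := [set x | odd (deg F x)].

Let degD F D x : D \subset F -> deg F x = deg D x + deg (F :\: D) x.
Proof. by move=> sD; rewrite /deg (big_setID D) /= (setIidPr sD). Qed.

(** A smallest edge set [F] with the same odd vertices as the whole graph is removed. Distinct
    subsets of [F] have distinct sets of odd vertices, so 2^|F| is at most the number of sets of
    active vertices, and [F] has at most as many edges as there are active vertices. *)
Lemma even_subrel : exists h : rel V, [/\ simple_rel h, subrel h a, even_rel h &
  \sum_x #|nbhd a x| <= \sum_x #|nbhd h x| + 2 * #|active a|].
Proof.
have ex : (edges \subset edges) && (par edges == par edges) by rewrite subxx eqxx.
pose F := [arg min_(F < edges | (F \subset edges) && (par F == par edges)) #|F|].
have [sF pF Fmin] : [/\ F \subset edges, par F = par edges &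
    forall F', F' \subset edges -> par F' = par edges -> #|F| <= #|F'|].
  rewrite /F; case: arg_minnP => // F1 /andP[-> /eqP->] m; split=> // F' s1 p1.
  by apply: m; rewrite s1 p1 eqxx.
(* If two subsets had the same odd vertices, their symmetric difference would be even and could be
   dropped from [F]. *)
have inj : {in powerset F &, injective par}.
  move=> F1 F2; rewrite !powersetE => s1 s2 p12.
  pose D := (F1 :\: F2) :|: (F2 :\: F1).
  have sD : D \subset F by rewrite subUset !subDset !subsetU ?s1 ?s2 ?orbT.
  have oD x : ~~ odd (deg D x).
    have -> : deg D x = deg (F1 :\: F2) x + deg (F2 :\: F1) x.
      rewrite /deg (big_setID (F1 :\: F2)) /=; congr (_ + _); apply: eq_bigl => P;
      by rewrite !inE; case: (_ \in F1); case: (_ \in F2).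
    have /setP/(_ x) := p12; rewrite !inE.
    have -> : deg F1 x = deg (F1 :&: F2) x + deg (F1 :\: F2) x by rewrite /deg (big_setID F2).
    have -> : deg F2 x = deg (F1 :&: F2) x + deg (F2 :\: F1) x.
      by rewrite /deg (big_setID F1) /= setIC.
    by rewrite !oddD => /addbI->; rewrite addbb.
  have : #|F| <= #|F :\: D|.
    apply: Fmin; first exact: subset_trans (subsetDl _ _) sF.
    rewrite -pF; apply/setP=> x; rewrite !inE (degD x sD) oddD.
    by rewrite (negPf (oD x)).
  rewrite -(cardsID D F) (setIidPr sD) -[leqRHS]add0n leq_add2r leqn0 cards_eq0.
  rewrite setU_eq0 !setD_eq0 => /andP[le1 le2].
  by apply/eqP; rewrite eqEsubset le1.
have cF : #|F| <= #|active a|.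
  rewrite -(leq_exp2l (m := 2)) // -!card_powerset -(card_in_imset inj).
  apply/subset_leq_card/subsetP => S /imsetP[F1]; rewrite powersetE => s1 ->.
  rewrite powersetE; apply/subsetP=> x; rewrite !inE; apply: contraTneq => N0.
  rewrite /deg big1 // => P PF; apply/eqP; rewrite eqb0; apply/negP => xP.
  have := subsetP sF P (subsetP s1 P PF).
  rewrite inE => /existsP[u /existsP[v /andP[auv /eqP E]]].
  move: xP; rewrite E !inE => /orP[] /eqP ux; move/setP: N0.
    by move/(_ v); rewrite !inE ux auv.
  by move/(_ u); rewrite !inE ux aS.1 auv.
have sE : edges :\: F \subset edges by apply: subsetDl.
exists (rel_of (edges :\: F)); split.
- exact: rel_of_simple.
- by move=> x y /andP[_ /setDP[]]; rewrite edgesE.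
- move=> x; rewrite nbhd_rel_of //.
  have /setP/(_ x) := pF; rewrite !inE (degD x sF) oddD.
  by case: (odd _); case: (odd _).
have nE x : #|nbhd a x| = deg edges x.
  rewrite -nbhd_rel_of //; apply: eq_card => y; rewrite !inE /rel_of -/edges edgesE.
  by case: eqVneq => // ->; rewrite aS.2.
rewrite (eq_bigr _ (fun x _ => nE x)) (eq_bigr _ (fun x _ => nbhd_rel_of x sE)).
rewrite !sum_deg // -mulnDr leq_mul2l /=.
by rewrite -(cardsID F edges) (setIidPr sF) addnC leq_add2l.
Qed.
End EvenSub.

(** * Splitting off vertices of small degree *)

Section MinDegree.
Variables (G : mgraph) (X : pred (edge G)).
Notation V := (vertex G).

(** The vertex [v] loses its whole degree and each of its neighbours loses at most two. *)
Lemma sum_dissolve (h : rel V) v (mu : V -> V) : simple_rel h ->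
  {in nbhd h v, involutive mu} -> (forall x, h v x -> h v (mu x)) ->
  (forall x, h v x -> mu x != x) ->
  \sum_x #|nbhd h x| <= \sum_x #|nbhd (dissolve h v mu) x| + 3 * #|nbhd h v|.
Proof.
move=> hS muK muN mux.
have -> : 3 * #|nbhd h v| = \sum_x ((x == v) * #|nbhd h v| + 2 * (x \in nbhd h v)).
  rewrite big_split /= (bigD1 v) //= eqxx mul1n big1 ?addn0; last first.
    by move=> x /negPf->.
  rewrite -big_distrr /= -sum1_card [X in _ + 2 * X](eq_bigr (fun x => if x \in nbhd h v then 1 else 0)).
    by rewrite -big_mkcond /=; lia.
  by move=> x _; case: (_ \in _).
rewrite -big_split /=; apply: leq_sum => x _.
have [->|nv] := eqVneq x v; first by rewrite mul1n; lia.
rewrite inE; have [hv|hv] := boolP (h v x); last by rewrite nbhd_dissolve_out //; lia.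
have [hm|hm] := boolP (h x (mu x)); last by rewrite card_dissolve_new //; lia.
by rewrite (card_dissolve_old hS muN hv hm); lia.
Qed.

(** Dissolving a vertex of degree below [c] lowers the degree sum by less than 3 c and removes an
    active vertex, so the strict inequality persists and keeps the final graph non-empty. *)
Lemma even_min_degree (h : rel V) c : simple_rel h -> carried X h -> even_rel h ->
  3 * c * #|active h| < \sum_x #|nbhd h x| ->
  exists h', [/\ simple_rel h', carried X h', even_rel h', active h' != set0 &
    forall x, nbhd h' x != set0 -> c <= #|nbhd h' x|].
Proof.
have [n] := ubnP #|active h|.
elim: n h => // n IH h; rewrite ltnS => le hS hC he big.
case: (boolP [exists v, (nbhd h v != set0) && (#|nbhd h v| < c)]); last first.
  move/existsPn => small; exists h; split=> //.
    apply: contraTneq big => act0; rewrite big1 // => x _.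
    by have /setP/(_ x) := act0; rewrite !inE => /negbFE/eqP->; rewrite cards0.
  by move=> x nx; have := small x; rewrite nx /= -leqNgt.
case/existsP=> v /andP[nv lt].
have [mu muP] := even_pairing (he v).
have muK : {in nbhd h v, involutive mu}.
  by move=> x /muP[].
have muN x : h v x -> h v (mu x) by have := muP x; rewrite !inE => H /H[].
have mux x : h v x -> mu x != x by have := muP x; rewrite !inE => H /H[].
have sact : active (dissolve h v mu) \subset active h :\ v.
  apply/subsetP=> x; rewrite !inE.
  have [->|nxv] := eqVneq x v; first by rewrite nbhd_dissolve_v eqxx.
  apply: contraNneq => N0; have nh : ~~ h v x.
    by apply/negP => hvx; move/setP/(_ v): N0; rewrite !inE hS.1 hvx.
  by rewrite nbhd_dissolve_out // N0.
have vact : v \in active h by rewrite inE.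
have cact : #|active (dissolve h v mu)| < #|active h|.
  by rewrite [leqRHS](cardsD1 v) vact add1n ltnS subset_leq_card.
apply: (IH (dissolve h v mu)).
- exact: leq_trans cact le.
- exact: dissolve_simple.
- exact: dissolve_carried.
- exact: dissolve_even.
have := sum_dissolve hS muK muN mux.
move: big cact lt; move: (\sum_x _) (\sum_x _) => S1 S2; clear; nia.
Qed.
End MinDegree.

(** * Clique immersions *)

Section Clique.
Variables (G : mgraph) (X : pred (edge G)) (s : nat).
Notation V := (vertex G).

(** Missing pairs of [S] are joined one at a time by rerouting through a common neighbour outside
    [S]. *)
Lemma clique_of_dense (h : rel V) : 0 < s -> simple_rel h -> carried X h -> dense s h ->
  exists (h' : rel V) (S : {set V}), [/\ carried X h', #|S| = s &
    {in S &, forall x y, x != y -> h' x y}].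
Proof.
move=> s0 hS hC /existsP[S /andP[/eqP cS /forall_inP dS]].
have {}dS : {in S &, forall x y, x != y -> 4 * s <= #|nbhd h x :&: nbhd h y|}.
  by move=> x y xS yS; have /forall_inP/(_ y yS)/implyP := dS x xS.
(* Invariant: a vertex of [S] has lost at most as many neighbours outside [S] as it has neighbours
   inside, hence fewer than [s]. *)
have step n (h1 : rel V) : simple_rel h1 -> carried X h1 ->
    {in S, forall p, #|(nbhd h p :\: S) :\: nbhd h1 p| <= #|nbhd h1 p :&: S|} ->
    #|[set u : V * V | [&& u.1 \in S, u.2 \in S, u.1 != u.2 & ~~ h1 u.1 u.2]]| < n ->
  exists h' : rel V, carried X h' /\ {in S &, forall x y, x != y -> h' x y}.
  elim: n h1 => // n IH h1 h1S h1C inv; rewrite ltnS => le.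
  set M := [set u : V * V | _] in le.
  have [M0|[[p q] pqM]] := set_0Vmem M.
    exists h1; split=> // x y xS yS nxy; apply: contraT => nh.
    by have /setP/(_ (x, y)) := M0; rewrite !inE /= xS yS nxy nh.
  have /and4P[/= pS qS npq nh] : [&& p \in S, q \in S, p != q & ~~ h1 p q].
    by move: pqM; rewrite inE.
  have nqp : q != p by rewrite eq_sym.
  pose B := (nbhd h p :&: nbhd h q) :\: S.
  have cB : 3 * s <= #|B|.
    have := dS p q pS qS npq; rewrite -(cardsID S) => c4.
    have : #|nbhd h p :&: nbhd h q :&: S| <= s by rewrite -cS subset_leq_card ?subsetIr.
    by move: c4; rewrite /B; clear; lia.
  have lost x : x \in S -> B \subset nbhd h x -> #|B :\: nbhd h1 x| < s.
    move=> xS sB; apply: leq_ltn_trans (_ : #|nbhd h1 x :&: S| < _).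
      apply: leq_trans (inv x xS); apply/subset_leq_card/setSD.
      by rewrite subsetD sB disjoint_sym disjoints_subset; apply/subsetP=> z zS; rewrite !inE zS.
    rewrite -cS; apply/proper_card/properP; split; first exact: subsetIr.
    by exists x; rewrite // !inE h1S.2.
  have [w] : exists w, w \in B :&: (nbhd h1 p :&: nbhd h1 q).
    apply/set0Pn; rewrite -card_gt0.
    have lp : #|B :\: nbhd h1 p| < s.
      by apply: lost pS _; apply/subsetP=> z; rewrite !inE => /andP[_ /andP[]].
    have lq : #|B :\: nbhd h1 q| < s.
      by apply: lost qS _; apply/subsetP=> z; rewrite !inE => /andP[_ /andP[]].
    have := cardsID (nbhd h1 p :&: nbhd h1 q) B.
    have : #|B :\: (nbhd h1 p :&: nbhd h1 q)| <= #|B :\: nbhd h1 p| + #|B :\: nbhd h1 q|.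
      by rewrite setDIr leq_card_setU.
    by move: lp lq cB; clear; lia.
  rewrite !inE => /and3P[/and3P[wS hpw hqw] h1pw h1qw].
  have h1wq : h1 w q by rewrite h1S.1.
  have npw : p != w by apply: contraNneq wS => <-.
  have nqw : q != w by apply: contraNneq wS => <-.
  pose h2 := reroute h1 p [:: w; q].
  have h2E x y : h2 x y = ([set x; y] == [set p; q]) ||
      h1 x y && ([set x; y] \notin [:: [set p; w]; [set w; q]]) by [].
  have h2x x : x \in S -> x != p -> x != q -> nbhd h2 x = nbhd h1 x.
    move=> xS nxp nxq; have nxw : x != w by apply: contraNneq wS => <-.
    apply/setP=> y; rewrite !inE h2E !inE !set2_eqb.
    by rewrite (negPf nxp) (negPf nxq) (negPf nxw) /= andbT.
  have h2p : nbhd h2 p = q |: (nbhd h1 p :\ w).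
    apply/setP=> y; rewrite !inE h2E !inE !set2_eqb eqxx (negPf npq) (negPf npw) /=.
    by rewrite !orbF andbC.
  have h2q : nbhd h2 q = p |: (nbhd h1 q :\ w).
    apply/setP=> y; rewrite !inE h2E !inE !set2_eqb eqxx (negPf nqp) (negPf nqw) /=.
    by rewrite andbC.
  (* The new neighbour [y] inside [S] pays for the lost neighbour [w]. *)
  have inv2 x y : x \in S -> y \in S -> ~~ h1 x y ->
      #|(nbhd h x :\: S) :\: (y |: (nbhd h1 x :\ w))| <= #|(y |: (nbhd h1 x :\ w)) :&: S|.
    move=> xS yS nxy.
    apply: leq_trans (_ : (#|(nbhd h x :\: S) :\: nbhd h1 x|).+1 <= _).
      apply: leq_trans (cardsU1_le w _); apply/subset_leq_card/subsetP=> z.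
      rewrite !inE !negb_or negb_and negbK => /and3P[/andP[_ zz] zS hz].
      by rewrite zS hz !andbT.
    apply: leq_ltn_trans (inv x xS) _.
    have -> : (y |: (nbhd h1 x :\ w)) :&: S = y |: (nbhd h1 x :&: S).
      apply/setP=> z; rewrite !inE; case: (eqVneq z y) => [->|_] /=; first by rewrite yS.
      by case: (eqVneq z w) => [->|] //=; rewrite (negPf wS) andbF.
    by rewrite cardsU1 !inE (negPf nxy).
  apply: (IH h2).
  - exact: reroute_simple.
  - apply: reroute_carried => //; first exact: h1S.1.
      by rewrite /= h1pw h1wq.
    by rewrite /= inE set2_eqb (negPf npw) (negPf npq).
  - move=> x xS; have [->|nxp] := eqVneq x p; first by rewrite h2p inv2.
    have [->|nxq] := eqVneq x q; first by rewrite h2q inv2 // h1S.1.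
    by rewrite h2x // inv.
  apply: leq_trans le; apply/proper_card/properP; split; last first.
    by exists (p, q); last by rewrite !inE /= h2E eqxx /= !andbF.
  apply/subsetP=> -[x y]; rewrite !inE /= => /and4P[xS yS -> nxy]; rewrite xS yS /=.
  apply: contra nxy => hxy; rewrite h2E hxy /= !inE !set2_eqb.
  have nxw : x != w by apply: contraNneq wS => <-.
  have nyw : y != w by apply: contraNneq wS => <-.
  by rewrite (negPf nxw) (negPf nyw) !andbF /= orbT.
have [|h' [h'C h'S]] := step _ h hS hC _ (ltnSn _); last by exists h', S.
by move=> p pS; rewrite setDDl setUC -setDDl setDv set0D cards0.
Qed.

(** In the constant 150 s + 2, the 2 pays for passing to an even subgraph and 150 s is three times
    the minimum degree 50 s wanted in [even_min_degree]. *)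
Lemma dense_exists (a : rel V) : 1 < s -> simple_rel a -> carried X a ->
  (150 * s + 2) * #|active a| < \sum_x #|nbhd a x| ->
  (forall h : rel V, simple_rel h -> carried X h -> ~~ dense s h) -> False.
Proof.
move=> s1 aS aC big nd.
have [h [hS sub he le]] := even_subrel aS.
have sact : #|active h| <= #|active a|.
  apply/subset_leq_card/subsetP=> x; rewrite !inE; apply: contraNneq => a0.
  rewrite -subset0 -a0; apply/subsetP=> y; rewrite !inE; apply: sub.
have [|h' [h'S h'C h'e nz md]] := even_min_degree (c := 50 * s) hS (carried_sub sub aC) he.
  move: le big sact; move: (\sum_x _) (\sum_x _) => S1 S2; clear; nia.
by rewrite (no_even_min_degree s1 nd h'S h'C h'e md) eqxx in nz.
Qed.

End Clique.

(** * Integral flows in undirected multigraphs *)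

Section Flow.
Variables (G : mgraph) (I : finType).
Notation V := (vertex G).
Notation E := (edge G).

Definition crosses (e : E) (S : {set V}) : bool :=
  ((ends e).1 \in S) (+) ((ends e).2 \in S).

Lemma crosses_joins e x y S : joins e x y -> crosses e S = (x \in S) (+) (y \in S).
Proof. by rewrite /joins /crosses => /orP[] /eqP-> //=; rewrite addbC. Qed.

Definition cut_size (B : {set E}) S := \sum_(e in B) (crosses e S).

(** Each [i] in [A] is a unit of flow starting at [w i], and a vertex [x] can absorb [cap x] units:
    this is the cut side of max-flow min-cut. *)
Definition cut_condition (B : {set E}) (A : {set I}) (w : I -> V) (cap : V -> nat) :=
  [forall S : {set V}, \sum_(i in A) (w i \in S) <= cut_size B S + \sum_x (x \in S) * cap x].

(* In a minimal B every edge lies in a tight cut. If an edge at the source x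
   leaves a tight set containing x, then x can be moved along it, by uncrossing.
   Otherwise a maximal tight set avoiding x contains all neighbours of x, and
   the cut condition forces x to have positive capacity. *)
Lemma flow_exists (B : {set E}) (A : {set I}) (w : I -> V) (cap : V -> nat) :
  cut_condition B A w cap ->
  exists (U : I -> seq E) (tgt : I -> V), [/\
    {in A, forall i, [/\ traverses (w i) (U i) (tgt i), uniq (U i) & {subset U i <= B}]},
    {in A &, forall i j e, e \in U i -> e \in U j -> i = j} &
    forall x, #|[set i in A | tgt i == x]| <= cap x].
Proof.
have [n] := ubnP (#|B| + #|A|).
elim: n B A w cap => // n IH B A w cap; rewrite ltnS => le cc.
have [A0|[i iA]] := set_0Vmem A.
  exists (fun _ => [::]), w; rewrite A0; split=> [i|i j|x]; rewrite ?inE //.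
  rewrite (_ : [set _ in _ | _] = set0) ?cards0 //.
  by apply/setP=> i; rewrite !inE.
have [|minB] := boolP [exists e in B, cut_condition (B :\ e) A w cap].
  case/exists_inP=> e eB cc'; have [|U [tgt [H1 H2 H3]]] := IH _ _ _ _ _ cc'.
    by apply: leq_trans le; rewrite (cardsD1 e B) eB.
  exists U, tgt; split=> // j /H1[h1 h2 h3]; split=> // f /h3.
  by case/setD1P.
pose cnt (S : {set V}) := \sum_(i in A) (w i \in S).
pose cp (S : {set V}) := \sum_x (x \in S) * cap x.
pose d (S : {set V}) := cut_size B S.
have cond S : cnt S <= d S + cp S by have /forallP/(_ S) := cc.
pose tight S := cnt S == d S + cp S.
have dD1 e S : e \in B -> d S = crosses e S + cut_size (B :\ e) S.
  by move=> eB; rewrite /d /cut_size (big_setD1 e).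
(* Deleting [e] violates the condition at some set; that set is tight and crossed by [e]. *)
have tightE e : e \in B -> exists2 S, tight S & crosses e S.
  move=> eB; move: minB; rewrite negb_exists_in => /forall_inP/(_ e eB).
  rewrite negb_forall => /existsP[S]; rewrite -ltnNge => lt.
  have := cond S; rewrite (dD1 e) // => le1.
  move: lt le1; rewrite -/(cnt S) -/(cp S) => lt le1; exists S.
    by rewrite /tight (dD1 e) //; move: lt le1; case: crosses; clear; lia.
  by move: lt le1; case: crosses => //; clear; lia.
have cntM S T : cnt S + cnt T = cnt (S :&: T) + cnt (S :|: T).
  rewrite /cnt -!big_split; apply: eq_bigr => j _; rewrite !inE.
  by case: (_ \in S); case: (_ \in T).
have cpM S T : cp S + cp T = cp (S :&: T) + cp (S :|: T).
  rewrite /cp -!big_split; apply: eq_bigr => j _; rewrite !inE /=.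
  by case: (_ \in S); case: (_ \in T); rewrite ?addn0 ?add0n.
have cut_sub (B' : {set E}) S T :
    cut_size B' (S :&: T) + cut_size B' (S :|: T) <= cut_size B' S + cut_size B' T.
  rewrite /cut_size -!big_split; apply: leq_sum => e _; rewrite /crosses !inE.
  by do 2 case: (_ \in S); do 2 case: (_ \in T).
set x := w i.
have [[e [S [y [eB tS xS jxy yS]]]]|stuck] :
  (exists e S y, [/\ e \in B, tight S, x \in S, joins e x y & y \notin S]) \/
  (forall e S y, e \in B -> tight S -> joins e x y -> x \in S -> y \in S).
- case: (boolP [exists e in B, exists S : {set V}, exists y,
      [&& tight S, x \in S, joins e x y & y \notin S]]) => [ex|no]; [left|right].
    case/exists_inP: ex => e eB /existsP[S /existsP[y /and4P[? ? ? ?]]].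
    by exists e, S, y; split.
  move=> e S y eB tS jxy xS; apply: contraT => yS.
  move: no; rewrite negb_exists_in => /forall_inP/(_ e eB).
  by move/existsPn/(_ S)/existsPn/(_ y); rewrite tS xS jxy yS.
- pose w' j := if j == i then y else w j.
  have cc' : cut_condition (B :\ e) A w' cap.
    apply/forallP=> T; have condT := cond T.
    have cntT : \sum_(j in A) (w' j \in T) + (x \in T) = cnt T + (y \in T).
      rewrite /cnt (big_setD1 i) //= (big_setD1 i iA) /= /w' eqxx.
      rewrite (eq_bigr (fun j => nat_of_bool (w j \in T))) => [|j /setD1P[/negPf->]] //.
      by rewrite -/x; lia.
    have := dD1 e T eB; rewrite (crosses_joins _ jxy) => dT.
    (* The only sets endangered by the move contain [y] but not [x]. The edge crosses both [S] and
       [T] but neither their intersection nor their union, so uncrossing with the tight set [S]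
       leaves a slack of 2. *)
    have un : x \notin T -> y \in T -> cnt T + 2 <= d T + cp T.
      move=> xT yT; have := cut_sub (B :\ e) S T.
      have := dD1 e S eB; have := cond (S :&: T); have := cond (S :|: T).
      rewrite (dD1 e (S :&: T)) // (dD1 e (S :|: T)) //.
      rewrite !(crosses_joins _ jxy) !inE xS (negPf yS) (negPf xT) yT /=.
      move: dT; rewrite (negPf xT) yT /=.
      have := cntM S T; have := cpM S T; move/eqP: tS; clear; lia.
    rewrite -/(cp T); move: cntT dT condT un.
    by case: (x \in T); case: (y \in T) => //= *; try lia; have := un isT isT; lia.
  have [|U [tgt [H1 H2 H3]]] := IH _ _ _ _ _ cc'.
    by apply: leq_trans le; rewrite (cardsD1 e B) eB.
  pose U' j := if j == i then e :: U j else U j.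
  have eU j : j \in A -> e \notin U j.
    by move=> jA; apply/negP; have [_ _ sub] := H1 j jA; move/sub; rewrite !inE eqxx.
  exists U', tgt; split=> //.
    move=> j jA; have [t1 u1 s1] := H1 j jA; move: t1; rewrite /U' /w'.
    case: (eqVneq j i) => [ji|nji] t1; last first.
      by split=> // f /s1/setD1P[].
    split; first by rewrite ji -/x; exists y; rewrite -?ji.
      by rewrite /= u1 eU.
    by move=> f; rewrite inE => /orP[/eqP->//|/s1/setD1P[]].
  move=> j k jA kA f; rewrite /U'.
  case: (eqVneq j i) => [ji|nji]; case: (eqVneq k i) => [ki|nki].
  + by rewrite ji ki.
  + rewrite inE => /orP[/eqP->|]; first by rewrite (negPf (eU k kA)).
    by move=> fj fk; apply: (H2 _ _ jA kA f).
  + rewrite inE => fj /orP[/eqP fe|]; first by move: fj; rewrite fe (negPf (eU j jA)).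
    by move=> fk; apply: (H2 _ _ jA kA f).
  + by move=> fj fk; apply: (H2 _ _ jA kA f).
have capx : 0 < cap x.
  have t0 : tight set0 && (x \notin set0).
    rewrite inE /tight /cnt /cp /d /cut_size !big1 // => z _; rewrite ?inE //.
    by rewrite /crosses !inE.
  pose S := [arg max_(S > set0 | tight S && (x \notin S)) #|S|].
  have [tS xS Smax] : [/\ tight S, x \notin S &
      forall T, tight T -> x \notin T -> #|T| <= #|S|].
    rewrite /S; case: arg_maxnP => // T /andP[tT xT] m; split=> // T' t' x'.
    by apply: m; rewrite t' x'.
  have tU T : tight T -> x \notin T -> T \subset S.
    move=> tT xT; have tST : tight (S :|: T).
      move: tS tT; rewrite /tight.
      have := cut_sub B S T; have := cntM S T; have := cpM S T.
      have := cond (S :|: T); have := cond (S :&: T); rewrite -!/(d _).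
      by clear; lia.
    have := Smax _ tST; rewrite !inE negb_or xS => /(_ xT) leS.
    have : S :|: T == S by rewrite eq_sym eqEcard subsetUl.
    by move/eqP <-; apply: subsetUr.
  have adj e y : e \in B -> joins e x y -> y != x -> y \in S.
    move=> eB jxy nyx; have [T tT] := tightE e eB.
    rewrite (crosses_joins _ jxy); have [xT|xT] := boolP (x \in T).
      by rewrite (stuck e T y).
    by move=> /= yT; apply: (subsetP (tU T tT xT)).
  (* All neighbours of [x] other than itself lie in [S], so adding [x] does not enlarge the cut
     while the demand grows; the capacity of [x] must make up for it. *)
  have dx : d (x |: S) <= d S.
    apply: leq_sum => e eB; rewrite leqNgt; apply/negP.
    case cS: (crosses e S) => //; case cxS: (crosses e (x |: S)) => // _.
    have join1 : joins e (ends e).1 (ends e).2 by rewrite /joins -surjective_pairing eqxx.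
    have join2 : joins e (ends e).2 (ends e).1 by rewrite /joins -surjective_pairing eqxx orbT.
    move: cS cxS; rewrite /crosses !inE.
    case: (eqVneq (ends e).1 x) => [e1|n1]; case: (eqVneq (ends e).2 x) => [e2|n2] //=.
    - by rewrite e1 in join1; rewrite (adj e _ eB join1 n2).
    - by rewrite e2 in join2; rewrite (adj e _ eB join2 n1).
    - by move=> ->.
  have := cond (x |: S); have cx : cp (x |: S) = cap x + cp S.
    rewrite /cp (bigD1 x) //= [in RHS](bigD1 x) //= setU11 (negPf xS) mul1n mul0n.
    by congr (_ + _); apply: eq_bigr => z /negPf nz; rewrite !inE nz.
  have : cnt S < cnt (x |: S).
    rewrite /cnt (big_setD1 i) //= [in ltnRHS](big_setD1 i) //= -/x setU11 (negPf xS).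
    by rewrite ltnS; apply: leq_sum => j _; rewrite !inE; case: (_ \in S); rewrite ?orbT.
  by move: tS dx cx; rewrite /tight; clear; lia.
(* The unit [i] stops at [x] with an empty trail and uses up one unit of capacity there. *)
pose cap' y := cap y - (y == x).
have cc' : cut_condition B (A :\ i) w cap'.
  apply/forallP=> T; have := cond T; rewrite /cnt (big_setD1 i) //= -/x.
  have -> : cp T = (x \in T) + \sum_y (y \in T) * cap' y.
    rewrite /cp (bigD1 x) //= [in RHS](bigD1 x) //= addnA; congr (_ + _).
      by rewrite /cap' eqxx; case: (x \in T); rewrite ?mul0n // !mul1n subnKC.
    by apply: eq_bigr => y /negPf ny; rewrite /cap' ny subn0.
  by rewrite addnCA leq_add2l.
have [|U [tgt [H1 H2 H3]]] := IH _ _ _ _ _ cc'.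
  by apply: leq_trans le; rewrite (cardsD1 i A) iA addnCA.
exists (fun j => if j == i then [::] else U j), (fun j => if j == i then x else tgt j).
split.
- move=> j jA; case: (eqVneq j i) => [->|nji]; first by split.
  by apply: H1; rewrite !inE nji.
- move=> j k jA kA f; case: (eqVneq j i) => [->|nji] //.
  case: (eqVneq k i) => [->|nki] //; apply: H2; by rewrite !inE ?nji ?nki.
move=> y; have := H3 y; rewrite /cap' => Hy.
rewrite (cardsD1 i) !inE iA eqxx /= eq_sym.
apply: leq_trans (_ : (y == x) + (cap y - (y == x)) <= _).
  rewrite leq_add2l; apply: leq_trans Hy; apply/subset_leq_card/subsetP=> j.
  by rewrite !inE; case: (eqVneq j i) => //= _ /andP[-> ->].
by rewrite subnKC //; case: eqVneq => // ->.
Qed.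
End Flow.

(** * Routing odd trails *)

(** Values are chosen one at a time; an earlier choice at [q] forbids at most [bd p q] values at
    [p]. The element [f0] only fills the function before any choice is made. *)
Lemma greedy_choice (P F : finType) (f0 : F) (Adm : P -> {set F})
    (conf : P -> F -> P -> F -> bool) (bd : P -> P -> nat) :
  (forall p f q g, conf p f q g = conf q g p f) ->
  (forall p q g, p != q -> #|[set f in Adm p | conf p f q g]| <= bd p q) ->
  (forall p, \sum_(q | q != p) bd p q < #|Adm p|) ->
  exists phi : P -> F, (forall p, phi p \in Adm p) /\
    forall p q, p != q -> ~~ conf p (phi p) q (phi q).
Proof.
move=> csym cbd big.
suff [phi [H1 H2]] : exists phi : P -> F, {in [set: P], forall p, phi p \in Adm p} /\
    {in [set: P] &, forall p q, p != q -> ~~ conf p (phi p) q (phi q)}.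
  by exists phi; split=> [p|p q]; [apply: H1|apply: H2]; rewrite inE.
move: [set: P] => D; have [n] := ubnP #|D|.
elim: n D => // n IH D; rewrite ltnS => le.
have [->|[p pD]] := set_0Vmem D.
  by exists (fun _ => f0); split=> p; rewrite inE.
have [|phi [H1 H2]] := IH (D :\ p).
  by move: le; rewrite (cardsD1 p D) pD.
have [f fA fC] : exists2 f, f \in Adm p & forall q, q \in D :\ p -> ~~ conf p f q (phi q).
  have : ~~ (Adm p \subset \bigcup_(q | q != p) [set f in Adm p | conf p f q (phi q)]).
    apply: contraL (big p) => /subset_leq_card le1; rewrite -leqNgt.
    apply: leq_trans le1 _.
    apply: (@leq_trans (\sum_(q | q != p) #|[set f in Adm p | conf p f q (phi q)]|)).
      elim/big_rec2: _ => [|q k U _ IHk]; first by rewrite cards0.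
      by apply: leq_trans (leq_card_setU _ _) _; rewrite leq_add2l.
    by apply: leq_sum => q nq; apply: cbd; rewrite eq_sym.
  case/subsetPn=> f fA nf; exists f => // q /setD1P[nq _].
  by apply: contra nf => cf; apply/bigcupP; exists q; rewrite // inE fA.
exists (fun q => if q == p then f else phi q); split.
  move=> q qD; case: (eqVneq q p) => [->//|nq].
  by apply: H1; rewrite !inE nq.
move=> q q' qD qD' nqq; case: (eqVneq q p) => [qp|nq]; case: (eqVneq q' p) => [qp'|nq'].
- by rewrite qp qp' eqxx in nqq.
- by rewrite qp; apply: fC; rewrite !inE nq'.
- by rewrite qp' csym; apply: fC; rewrite !inE nq.
- by apply: H2; rewrite ?inE ?nq ?nq'.
Qed.

Section Route.
Variables (G : mgraph) (X : pred (edge G)).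
Notation V := (vertex G).
Notation E := (edge G).
Variables (h : rel V) (T : V -> V -> seq E) (own : E -> {set V}) (S : {set V}).
Hypotheses (cT : carrier X h T own) (clS : {in S &, forall x y, x != y -> h x y}).
Variables (t : nat) (r : 'I_t -> V).
Hypotheses (r_inj : injective r) (rS : forall i, r i \in S).
(** A link [f] in [L] has the trail [ltr f] from [la f] to [lb f], and the branch trail from [r i]
    to [r j] is a trail to [la f], the link, and a trail from [lb f]. Links sharing an edge have
    equal [key], and [D] bounds the number of links with a given end. *)
Variables (K : eqType) (L : {set V * V}) (la lb : V * V -> V) (ltr : V * V -> seq E)
  (key : V * V -> K) (D : nat).

Hypotheses
  (laS : forall f, f \in L -> la f \in S) (laR : forall f i, f \in L -> la f != r i)
  (lbS : forall f, f \in L -> lb f \in S) (lbR : forall f i, f \in L -> lb f != r i)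
  (ltr_trav : forall f, f \in L -> traverses (la f) (ltr f) (lb f))
  (ltr_uniq : forall f, f \in L -> uniq (ltr f))
  (ltr_con : forall f e i p, f \in L -> e \in ltr f -> p \in S -> p != r i ->
     e \notin T (r i) p /\ e \notin T p (r i))
  (ltr_key : forall f g e, f \in L -> g \in L -> e \in ltr f -> e \in ltr g ->
     key f = key g)
  (la_card : forall x, #|[set f in L | la f == x]| <= D)
  (lb_card : forall x, #|[set f in L | lb f == x]| <= D)
  (key_card : forall k, #|[set f in L | key f == k]| <= 2).

Definition admissible (i j : 'I_t) := [set f in L |
  odd (size (T (r i) (la f)) + size (ltr f) + size (T (lb f) (r j)))].

Hypothesis adm_big : forall i j : 'I_t, i < j ->
  2 * (t * t) + 4 * (t * D) < #|admissible i j|.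

(** Greedy choice of a link for each pair. At most t^2 other pairs each forbid two links through
    [key]; sharing a branch vertex forbids [D] links, and for each of four position patterns this
    concerns at most [t] pairs. *)
Lemma route : V * V -> contains_totally_odd_immersion G (complete_graph t).
Proof.
move=> f0; pose P := edge (complete_graph t).
pose p1 (p : P) : 'I_t := (val p).1; pose p2 (p : P) : 'I_t := (val p).2.
have p12 p : p1 p < p2 p by apply: (valP p).
have np12 p : p1 p != p2 p by rewrite neq_ltn p12.
pose conf (p : P) f (q : P) g := [|| key f == key g,
  (p1 p == p1 q) && (la f == la g), (p2 p == p2 q) && (lb f == lb g),
  (p1 p == p2 q) && (la f == lb g) | (p2 p == p1 q) && (lb f == la g)].
pose bd p q := 2 + ((p1 p == p1 q) * D + (p2 p == p2 q) * D +
  ((p1 p == p2 q) * D + (p2 p == p1 q) * D)).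
have [|||phi [phiA phiC]] :=
    @greedy_choice P (V * V)%type f0 (fun p => admissible (p1 p) (p2 p)) conf bd.
- move=> p f q g; rewrite /conf (eq_sym (key g) (key f)) (eq_sym (p1 q) (p1 p)).
  rewrite (eq_sym (la g) (la f)) (eq_sym (p2 q) (p2 p)) (eq_sym (lb g) (lb f)).
  rewrite (eq_sym (p1 q) (p2 p)) (eq_sym (la g) (lb f)) (eq_sym (p2 q) (p1 p)).
  by rewrite (eq_sym (lb g) (la f)); do 3!congr (_ || _); rewrite orbC.
- move=> p q g _; pose Lx (b : bool) (m : pred (V * V)) := [set f in L | b && m f].
  apply: (@leq_trans #|[set f in L | key f == key g] :|:
    ((Lx (p1 p == p1 q) (fun f => la f == la g) :|: Lx (p2 p == p2 q) (fun f => lb f == lb g))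
     :|: (Lx (p1 p == p2 q) (fun f => la f == lb g) :|: Lx (p2 p == p1 q) (fun f => lb f == la g)))|).
    apply/subset_leq_card/subsetP=> f; rewrite !inE /conf.
    by case/andP=> /andP[-> _] /or4P[->|->|->|/orP[]->]; rewrite ?orbT.
  have Lb (b : bool) m : #|[set f in L | m f]| <= D -> #|Lx b m| <= b * D.
    case: b => le; first by rewrite mul1n.
    by rewrite (_ : Lx _ _ = set0) ?cards0 //; apply/setP=> z; rewrite !inE andbF.
  do ![apply: leq_trans (leq_card_setU _ _) _; apply: leq_add]; rewrite ?key_card //;
  by apply: Lb.
- move=> p; apply: leq_ltn_trans (adm_big (p12 p)).
  (* A pair with a prescribed vertex in one position is determined by its other vertex. *)
  have sumx (m : 'I_t) (g : P -> 'I_t) : (g = p1 \/ g = p2) ->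
      \sum_(q : P) (m == g q) * D <= t * D.
    move=> Hg; rewrite -big_distrl leq_mul2r; apply/orP; right.
    rewrite (eq_bigr (fun q : P => if m == g q then 1 else 0)) => [|q _]; last by case: eqP.
    rewrite -big_mkcond sum1_card -[leqRHS](card_ord t).
    pose oth (q : P) : 'I_t := if g q == p1 q then p2 q else p1 q.
    rewrite -(@card_in_image _ _ oth); first exact: max_card.
    have np21 q : (p2 q == p1 q) = false by rewrite eq_sym (negPf (np12 q)).
    have ext q q' : p1 q = p1 q' -> p2 q = p2 q' -> q = q'.
      by move=> E1 E2; apply: val_inj; apply: injective_projections.
    move=> q q' /eqP/val_inj mq /eqP/val_inj mq'; rewrite /oth => E; apply: ext; move: E mq mq';
      case: Hg => ->; rewrite ?eqxx ?np21 => *; congruence.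
  apply: (@leq_trans (\sum_q bd p q)).
    by rewrite [leqRHS](bigID (fun q => q != p)) /= leq_addr.
  rewrite /bd !big_split /=; apply: leq_add; last first.
    apply: (@leq_trans (t * D + t * D + (t * D + t * D))); last by lia.
    by do !apply: leq_add; apply: sumx; [left|right|right|left].
  rewrite sum_nat_const mulnC leq_mul2l /= card_sig.
  apply: leq_trans (max_card _) _; by rewrite card_prod card_ord.
pose Z p := T (r (p1 p)) (la (phi p)) ++ ltr (phi p) ++ T (lb (phi p)) (r (p2 p)).
have phiL p : phi p \in L by have := phiA p; rewrite inE => /andP[].
have h1 p : h (r (p1 p)) (la (phi p)) by apply: clS; rewrite ?rS ?laS // eq_sym laR.
have h2 p : h (lb (phi p)) (r (p2 p)) by apply: clS; rewrite ?rS ?lbS // lbR.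
have oddZ p : odd (size (Z p)).
  by have := phiA p; rewrite inE => /andP[_]; rewrite /Z !size_cat addnA.
have ZD p q e : e \in Z p -> e \in Z q -> p = q.
  move=> eP eQ; apply/eqP; apply: contraT => npq; move: (phiC p q npq).
  rewrite /conf !negb_or !negb_and => /and5P[nk c1 c2 c3 c4].
  move: eP eQ; rewrite /Z !mem_cat => /or3P[] eP /or3P[] eQ.
  - have := carrier_own cT (h1 p) eP; rewrite (carrier_own cT (h1 q) eQ) => /set2_eqE.
    case=> [[/r_inj E1 E2]|[E1 _]]; first by move: c1; rewrite E1 E2 !eqxx.
    by have := laR (p1 q) (phiL p); rewrite E1 eqxx.
  - by have [] := ltr_con (phiL q) eQ (laS (phiL p)) (laR (p1 p) (phiL p)); rewrite eP.
  - have := carrier_own cT (h1 p) eP; rewrite (carrier_own cT (h2 q) eQ) => /set2_eqE.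
    case=> [[E1 _]|[E1 /r_inj E2]]; last by move: c3; rewrite E1 E2 !eqxx.
    by have := lbR (p1 p) (phiL q); rewrite E1 eqxx.
  - by have [] := ltr_con (phiL p) eP (laS (phiL q)) (laR (p1 q) (phiL q)); rewrite eQ.
  - by rewrite (ltr_key (phiL p) (phiL q) eP eQ) eqxx in nk.
  - by have [] := ltr_con (phiL p) eP (lbS (phiL q)) (lbR (p2 q) (phiL q)); rewrite eQ.
  - have := carrier_own cT (h2 p) eP; rewrite (carrier_own cT (h1 q) eQ) => /set2_eqE.
    case=> [[E1 _]|[/r_inj E1 E2]]; last by move: c4; rewrite E1 E2 !eqxx.
    by have := lbR (p1 q) (phiL p); rewrite -E1 eqxx.
  - by have [] := ltr_con (phiL q) eQ (lbS (phiL p)) (lbR (p2 p) (phiL p)); rewrite eP.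
  - have := carrier_own cT (h2 p) eP; rewrite (carrier_own cT (h2 q) eQ) => /set2_eqE.
    case=> [[E1 /r_inj E2]|[E1 _]]; first by move: c2; rewrite E1 E2 !eqxx.
    by have := lbR (p2 p) (phiL q); rewrite E1 eqxx.
exists r, Z; split; last exact: oddZ.
split=> //.
- move=> p q E; have : Z p <> [::] by move=> Z0; have := oddZ p; rewrite Z0.
  case Zp: (Z p) => [//|e s] _; apply: (ZD p q e); first by rewrite Zp mem_head.
  by rewrite -E Zp mem_head.
- move=> p u v juv; have tZ : traverses (r (p1 p)) (Z p) (r (p2 p)).
    apply: traverses_cat (carrier_trav cT (h1 p)) _.
    exact: traverses_cat (ltr_trav (phiL p)) (carrier_trav cT (h2 p)).
  split.
  + by move=> Z0; have := oddZ p; rewrite Z0.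
  + rewrite /Z cat_uniq (carrier_uniq cT (h1 p)) cat_uniq ltr_uniq // (carrier_uniq cT (h2 p)).
    rewrite !andbT /=; apply/andP; split; apply/hasPn => e; last first.
      move=> eT; apply/negP => eL.
      by have [_] := ltr_con (phiL p) eL (lbS (phiL p)) (lbR (p2 p) (phiL p)); rewrite eT.
    rewrite mem_cat => /orP[eL|eT]; apply/negP => eT1.
      by have [] := ltr_con (phiL p) eL (laS (phiL p)) (laR (p1 p) (phiL p)); rewrite eT1.
    have := carrier_own cT (h1 p) eT1; rewrite (carrier_own cT (h2 p) eT) => /set2_eqE.
    case=> [[E1 _]|[_ /r_inj E1]]; first by have := lbR (p1 p) (phiL p); rewrite E1 eqxx.
    by have := np12 p; rewrite E1 eqxx.
  + case/orP: juv => /eqP E.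
      have [<- <-] : p1 p = u /\ p2 p = v by rewrite /p1 /p2; split; rewrite (E : val p = _).
      by left.
    have [<- <-] : p1 p = v /\ p2 p = u by rewrite /p1 /p2; split; rewrite (E : val p = _).
    by right.
- by move=> p q npq e [eP eQ]; apply: npq; apply: ZD eP eQ.
Qed.
End Route.

(** * Maximum cuts *)

Section MaxCut.
Variable G : mgraph.
Notation V := (vertex G).
Notation E := (edge G).

(** Switching the side of every vertex of [S] exchanges crossing and non-crossing exactly for the
    edges leaving [S]. *)
Lemma max_cut_exists : exists A : {set V}, forall S : {set V},
  cut_size [set e | ~~ crosses e A] S <= cut_size [set e | crosses e A] S.
Proof.
pose sz (A : {set V}) := \sum_e (crosses e A).
pose A := [arg max_(A > set0 : {set V}) sz A].
have Amax B : sz B <= sz A by rewrite /A; case: arg_maxnP => // A0 _; apply.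
exists A => S; pose B := [set x | (x \in A) (+) (x \in S)].
have : sz B + cut_size [set e | crosses e A] S = sz A + cut_size [set e | ~~ crosses e A] S.
  rewrite /sz /cut_size [X in _ + X = _]big_mkcond [X in _ = _ + X]big_mkcond -!big_split.
  apply: eq_bigr => e _; rewrite !inE /crosses !inE.
  by do 2 case: (_ \in A); do 2 case: (_ \in S).
by have := Amax B; lia.
Qed.

Lemma traverses_side (A : {set V}) x s (y : V) : traverses x s y ->
  (forall e, e \in s -> ~~ crosses e A) -> (x \in A) = (y \in A).
Proof.
elim: s x => [|e s IH] x /=; first by move=> ->.
case=> z jxz tz cr; have := cr e (mem_head _ _).
rewrite (crosses_joins _ jxz) -(IH z tz) => [|f fs]; last by rewrite cr // inE fs orbT.
by case: (x \in A); case: (z \in A).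
Qed.

Lemma traverses_parity (A : {set V}) x s (y : V) : traverses x s y ->
  (forall e, e \in s -> crosses e A) -> odd (size s) = (x \in A) (+) (y \in A).
Proof.
elim: s x => [|e s IH] x /=; first by move=> -> _; rewrite addbb.
case=> z jxz tz cr; have := cr e (mem_head _ _).
rewrite (crosses_joins _ jxz) (IH z tz) => [|f fs]; last by rewrite cr // inE fs orbT.
by case: (x \in A); case: (z \in A); case: (y \in A).
Qed.

Lemma traverses_crosses (S : {set V}) x s (y : V) : traverses x s y ->
  x \in S -> y \notin S -> exists2 e, e \in s & crosses e S.
Proof.
elim: s x => [|e s IH] x /=; first by move=> -> ->.
case=> z jxz tz xS yS; have [zS|zS] := boolP (z \in S).
  by have [f fs cf] := IH z tz zS yS; exists f; rewrite // inE fs orbT.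
by exists e; rewrite ?mem_head // (crosses_joins _ jxz) xS (negPf zS).
Qed.

Definition other_end (e : E) (x : V) :=
  if (ends e).1 == x then (ends e).2 else (ends e).1.

Lemma joins_other e x z : joins e x z -> z = other_end e x.
Proof.
rewrite /joins /other_end => /orP[] /eqP-> /=; first by rewrite eqxx.
by case: eqP.
Qed.

Lemma injection_into (B : {set V}) t : t <= #|B| ->
  exists r : 'I_t -> V, injective r /\ forall i, r i \in B.
Proof.
move=> le; exists (fun i => enum_val (widen_ord le i)); split=> [i j|i].
  by move/enum_val_inj/(congr1 val) => /= /val_inj.
exact: enum_valP.
Qed.
End MaxCut.

(** * Odd trails made of one inner edge and a trail across the cut *)

Section OddLinks.
Variables (G : mgraph) (A : {set vertex G}).
Notation V := (vertex G).
Notation E := (edge G).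
Notation X := (fun e => ~~ crosses e A).
Hypothesis cutA : forall S : {set V},
  cut_size [set e | ~~ crosses e A] S <= cut_size [set e | crosses e A] S.
Variables (h : rel V) (T : V -> V -> seq E) (own : E -> {set V}) (S : {set V}).
Hypotheses (cT : carrier X h T own) (clS : {in S &, forall x y, x != y -> h x y}).

(** For each pair the first edge of its trail in [X] is kept, and a flow in the crossing edges
    carries its far end [w f] to some vertex of [P2], each absorbing [#|P1|] units. *)
Lemma odd_links (P1 P2 : {set V}) : P1 \subset S -> P2 \subset S -> [disjoint P1 & P2] ->
  exists (ltr : V * V -> seq E) (tgt : V * V -> V), [/\
    {in setX P1 P2, forall f, [/\ traverses f.1 (ltr f) (tgt f), uniq (ltr f),
       odd (size (ltr f)) & tgt f \in P2]},
    {in setX P1 P2, forall f e, e \in ltr f -> crosses e A \/ e \in T f.1 f.2},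
    {in setX P1 P2 &, forall f g e, e \in ltr f -> e \in ltr g -> f = g} &
    forall x, #|[set f in setX P1 P2 | tgt f == x]| <= #|P1|].
Proof.
move=> s1 s2 dis; pose I := (V * V)%type.
have hf f : f \in setX P1 P2 -> h f.1 f.2.
  case: f => a b; rewrite in_setX => /andP[/= aP bP]; apply: clS.
  - exact: (subsetP s1).
  - exact: (subsetP s2).
  - by apply: contraTneq aP => ->; rewrite (disjointFl dis).
pose w (f : I) := if T f.1 f.2 is e :: _ then other_end e f.1 else f.1.
have TE f : f \in setX P1 P2 -> exists e s, [/\ T f.1 f.2 = e :: s,
    joins e f.1 (w f) & traverses (w f) s f.2].
  move=> fP; have := carrier_trav cT (hf f fP); rewrite /w.
  case: (T f.1 f.2) => [|e s] /=.
    case: f fP => a b; rewrite in_setX => /andP[/= aP bP] ab.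
    by move: bP; rewrite -ab (disjointFr dis aP).
  by case=> z jz; rewrite -(joins_other jz) => tz; exists e, s.
have own_inj f g e : f \in setX P1 P2 -> g \in setX P1 P2 -> e \in T f.1 f.2 ->
    e \in T g.1 g.2 -> f = g.
  move=> fP gP ef eg; have := carrier_own cT (hf f fP) ef.
  rewrite (carrier_own cT (hf g gP) eg) => /set2_eqE.
  case: f g fP gP {ef eg} => [a b] [a' b']; rewrite !in_setX /=.
  case/andP=> aP bP /andP[aP' bP'] [[-> ->]//|[ab _]].
  by move: bP; rewrite -ab (disjointFr dis aP').
pose cap x := (x \in P2) * #|P1|.
(* For [w f] in [S0], either [f.2] lies in [S0] and capacity pays, or the rest of the trail to [f.2]
   leaves [S0] by an edge of [X]. These edges are distinct, so [cutA] bounds their number by the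
   crossing edges leaving [S0]. *)
have cc : cut_condition [set e | crosses e A] (setX P1 P2) w cap.
  apply/forallP=> S0; apply: leq_trans (leq_add (cutA S0) (leqnn _)).
  apply: (@leq_trans (\sum_(f in setX P1 P2) ((w f \in S0) && (f.2 \notin S0) + (f.2 \in S0)))).
    by apply: leq_sum => f _; case: (_ \in S0); case: (_ \in S0).
  rewrite big_split; apply: leq_add; last first.
    rewrite (eq_bigl (fun f => (f.1 \in P1) && (f.2 \in P2))) => [|[a b]]; last by rewrite in_setX.
    rewrite -(pair_big (mem P1) (mem P2) (fun _ b => nat_of_bool (b \in S0))) /=.
    rewrite sum_nat_const mulnC big_distrl /= big_mkcond /=.
    by apply: leq_sum => x _; rewrite /cap; case: (x \in P2); rewrite // mul1n.
  pose Ec := [set e | ~~ crosses e A & crosses e S0].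
  apply: (@leq_trans (\sum_(f in setX P1 P2) \sum_(e in Ec) (e \in T f.1 f.2))).
    apply: leq_sum => f fP; case: andP => //= -[wS bS].
    have [e [s [Ts jw tw]]] := TE f fP.
    have [e' es ce] := traverses_crosses tw wS bS.
    have eT : e' \in T f.1 f.2 by rewrite Ts inE es orbT.
    have eE : e' \in Ec by rewrite inE ce (carrier_sub cT (hf f fP) eT).
    by rewrite (bigD1 e') //= eT.
  rewrite exchange_big /= /cut_size [leqRHS]big_mkcond [leqLHS]big_mkcond.
  apply: leq_sum => e _; rewrite !inE; case: (crosses e A) => //=.
  case: (crosses e S0) => //=.
  rewrite (eq_bigr (fun f => if e \in T f.1 f.2 then 1 else 0)) => [|f _]; last by case: (_ \in _).
  rewrite -big_mkcondr sum1_card; apply/card_le1_eqP => f g.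
  by move=> /andP[fP ef] /andP[gP eg]; apply: own_inj gP fP eg ef.
have [U [tgt [H1 H2 H3]]] := flow_exists cc.
have tP f : f \in setX P1 P2 -> tgt f \in P2.
  move=> fP; apply: contraT => nt; have := H3 (tgt f).
  rewrite /cap (negPf nt) mul0n leqn0 cards_eq0 => /eqP/setP/(_ f).
  by rewrite inE fP eqxx inE.
have UA f e : f \in setX P1 P2 -> e \in U f -> crosses e A.
  by move=> /H1[_ _ sub] /sub; rewrite inE.
exists (fun f => take 1 (T f.1 f.2) ++ U f), tgt; split.
- move=> f fP; have [e [s [Ts jw tw]]] := TE f fP; have [tU uU _] := H1 f fP.
  have eT : e \in T f.1 f.2 by rewrite Ts mem_head.
  have eX := carrier_sub cT (hf f fP) eT.
  split; rewrite ?Ts /= ?take0 ?cat0s //=.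
  + by exists (w f).
  + by rewrite uU andbT; apply: contra eX; apply: UA.
  (* Trails in [X] stay on one side of the cut, so [w f] and [tgt f] are on the same side; the
     crossing part is even and the first edge makes the length odd. *)
  + rewrite (traverses_parity tU (fun e => UA f e fP)).
    have fS : f.1 \in S by case: (f) fP => a b; rewrite in_setX => /andP[/(subsetP s1)].
    have tS : tgt f \in S by apply: (subsetP s2); apply: tP.
    have -> : (w f \in A) = (f.1 \in A).
      by move: eX; rewrite (crosses_joins _ jw); case: (_ \in A); case: (_ \in A).
    have -> : (f.1 \in A) = (tgt f \in A); last by rewrite addbb.
    have [->//|ne] := eqVneq f.1 (tgt f).
    have hh := clS fS tS ne; apply: (traverses_side (carrier_trav cT hh)) => e' e'T.
    exact: (carrier_sub cT hh e'T).
  + exact: tP.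
- move=> f fP e; rewrite mem_cat => /orP[/mem_take eT|eU]; first by right.
  by left; apply: UA eU.
- move=> f g fP gP e; rewrite !mem_cat => /orP[/mem_take ef|ef] /orP[/mem_take eg|eg].
  + exact: own_inj fP gP ef eg.
  + by have := carrier_sub cT (hf f fP) ef; rewrite (UA g).
  + by have := carrier_sub cT (hf g gP) eg; rewrite (UA f).
  + exact: H2 fP gP _ ef eg.
- move=> x; apply: leq_trans (H3 x) _; rewrite /cap.
  by case: (x \in P2); rewrite ?mul1n.
Qed.

End OddLinks.

Lemma card_fst_eq (V : finType) (L : {set V * V}) x (B : {set V}) :
  (forall f, f \in L -> f.1 = x -> f.2 \in B) -> #|[set f in L | f.1 == x]| <= #|B|.
Proof.
move=> H; rewrite -(@card_in_imset _ _ snd); last first.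
  by move=> [a b] [a' b'] /=; rewrite !inE /= => /andP[_ /eqP->] /andP[_ /eqP->] ->.
by apply/subset_leq_card/subsetP=> b /imsetP[f]; rewrite inE => /andP[fL /eqP fx] ->; apply: H.
Qed.

Lemma card_snd_eq (V : finType) (L : {set V * V}) x (B : {set V}) :
  (forall f, f \in L -> f.2 = x -> f.1 \in B) -> #|[set f in L | f.2 == x]| <= #|B|.
Proof.
move=> H; rewrite -(@card_in_imset _ _ fst); last first.
  by move=> [a b] [a' b'] /=; rewrite !inE /= => /andP[_ /eqP->] /andP[_ /eqP->] ->.
by apply/subset_leq_card/subsetP=> b /imsetP[f]; rewrite inE => /andP[fL /eqP fx] ->; apply: H.
Qed.

Lemma sum_card_sections (V : finType) (B : {set V}) (F : V -> {set V}) :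
  \sum_(x in B) #|F x| = #|[set f | (f.1 \in B) && (f.2 \in F f.1)]|.
Proof.
rewrite -sum1_card (eq_bigl (fun f => (f.1 \in B) && (f.2 \in F f.1))); last first.
  by move=> f; rewrite in_set.
rewrite -(pair_big_dep (mem B) (fun x y => y \in F x) (fun _ _ => 1)) /=.
by apply: eq_bigr => x _; rewrite sum1_card.
Qed.

(** * Parities of the trails of the large clique *)

Section Parity.
Variables (G : mgraph) (A : {set vertex G}).
Notation V := (vertex G).
Notation E := (edge G).
Notation X := (fun e => ~~ crosses e A).
Hypothesis cutA : forall S : {set V},
  cut_size [set e | ~~ crosses e A] S <= cut_size [set e | crosses e A] S.
Variables (h : rel V) (T : V -> V -> seq E) (own : E -> {set V}) (S : {set V}).
Hypotheses (cT : carrier X h T own) (clS : {in S &, forall x y, x != y -> h x y}).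
Variable t : nat.
Hypotheses (t0 : 0 < t) (cS : #|S| = 2000 * t).

Let par x y := odd (size (T x y)).

(** The links are the clique trails avoiding the branch vertices. An unordered pair serves as key,
    being shared by its two orderings, and with D = 2000 t the greedy bound is 8002 t^2 < 9000
    t^2. *)
Lemma hub_route (r : 'I_t -> V) : injective r -> (forall i, r i \in S) ->
  (forall i j : 'I_t, i < j -> 9 * 1000 * (t * t) <
     #|[set f : V * V | [&& f.1 \in S :\: r @: setT, f.2 \in S :\: r @: setT, f.1 != f.2 &
        par (r i) f.1 (+) par f.1 f.2 (+) par f.2 (r j)]]|) ->
  contains_totally_odd_immersion G (complete_graph t).
Proof.
move=> r_inj rS big; set S' := S :\: r @: setT in big.
pose L := [set f : V * V | [&& f.1 \in S', f.2 \in S' & f.1 != f.2]].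
have LP f : f \in L -> [/\ f.1 \in S', f.2 \in S' & f.1 != f.2].
  by rewrite inE => /and3P.
have S'R x i : x \in S' -> x != r i.
  by case/setDP=> _; apply: contraNneq => ->; apply: imset_f; rewrite inE.
have S'S x : x \in S' -> x \in S by case/setDP.
have hL f : f \in L -> h f.1 f.2 by move=> /LP[? ? ?]; apply: clS; rewrite ?S'S.
have [x0 _] : exists x, x \in S.
  by apply/set0Pn; rewrite -card_gt0 cS; move: t0; clear; lia.
apply: (@route _ _ h T own S cT clS t r r_inj rS _ L fst snd (fun f => T f.1 f.2)
  (fun f => [set f.1; f.2]) (2000 * t)) (x0, x0).
- by move=> f /LP[/S'S].
- by move=> f i /LP[/S'R].
- by move=> f /LP[_ /S'S].
- by move=> f i /LP[_ /S'R].
- by move=> f /hL hf; apply: (carrier_trav cT hf).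
- by move=> f /hL hf; apply: (carrier_uniq cT hf).
- move=> f e i p fL ef pS npr; have /LP[f1 f2 _] := fL.
  have o1 := carrier_own cT (hL f fL) ef.
  have hrp : h (r i) p by apply: clS; rewrite ?rS // eq_sym.
  have hpr : h p (r i) by apply: clS; rewrite ?rS.
  have nri : r i \notin [set f.1; f.2].
    by rewrite !inE negb_or !(eq_sym (r i)) !S'R.
  split; apply: contra nri => eT; rewrite -o1.
    by rewrite (carrier_own cT hrp eT) set21.
  by rewrite (carrier_own cT hpr eT) set22.
- by move=> f g e fL gL ef eg; rewrite -(carrier_own cT (hL f fL) ef) (carrier_own cT (hL g gL) eg).
- by move=> x; rewrite -cS; apply: card_fst_eq => f /LP[_ /S'S].
- by move=> x; rewrite -cS; apply: card_snd_eq => f /LP[/S'S].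
- move=> k; have [f /andP[_ /eqP Ek]|no] := pickP [pred f in L | [set f.1; f.2] == k]; last first.
    rewrite (_ : [set _ in _ | _] = set0) ?cards0 //.
    by apply/setP=> f; have := no f; rewrite !inE.
  apply: (@leq_trans #|[set (f : V * V); (f.2, f.1)]|).
    apply/subset_leq_card/subsetP=> -[a b]; rewrite inE => /andP[_ /eqP].
    rewrite -Ek !inE /= => /set2_eqE[] [-> ->]; first by rewrite -surjective_pairing eqxx.
    by rewrite eqxx orbT.
  by rewrite cards2; case: (_ != _).
move=> i j ij; apply: leq_trans (_ : _ <= _) (leq_trans (big i j ij) _).
  by rewrite ltnS; clear; nia.
apply/subset_leq_card/subsetP=> f; rewrite in_set => /and4P[f1 f2 nf pf].
by rewrite in_set in_set f1 f2 nf !oddD.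
Qed.

Definition odd3 x y := [set f : V * V | [&& f.1 \in S :\ x :\ y, f.2 \in S :\ x :\ y,
  f.1 != f.2 & par x f.1 (+) par f.1 f.2 (+) par f.2 y]].

(** Any [t] vertices can serve as branch vertices: avoiding them costs at most 4000 t^2 of the 16000
    t^2 odd paths. *)
Lemma rich_route : {in S &, forall x y, x != y -> 16 * 1000 * (t * t) <= #|odd3 x y|} ->
  contains_totally_odd_immersion G (complete_graph t).
Proof.
move=> rich; have [|r [r_inj rS]] := @injection_into _ S t; first by rewrite cS leq_pmull.
apply: (hub_route r_inj rS) => i j ij; set R := r @: setT.
have nij : r i != r j by apply: contraTneq ij => /r_inj->; rewrite ltnn.
have := rich _ _ (rS i) (rS j) nij; set N := [set f | _].
have cR : #|R| = t by rewrite card_imset // cardsT card_ord.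
have : #|odd3 (r i) (r j)| <= #|N| + (#|setX R S| + #|setX S R|).
  apply: leq_trans (_ : #|N :|: (setX R S :|: setX S R)| <= _); last first.
    apply: leq_trans (leq_card_setU _ _) _; rewrite leq_add2l; exact: leq_card_setU.
  apply/subset_leq_card/subsetP=> -[a b]; rewrite !(in_setU, in_setX) !inE /=.
  case/and4P=> /and3P[_ _ aS] /and3P[_ _ bS] -> ->; rewrite aS bS !andbT.
  by rewrite -/R; case: (a \in R); case: (b \in R).
rewrite !cardsX cR cS; have : t <= t * t by rewrite leq_pmulr.
by clear -t0; nia.
Qed.

(* Where [par x p = a] and [par p y = b] do not depend on p, a path x p q y is odd
   unless [par p q = a (+) b], so almost all trails there have parity a (+) b. *)
Lemma poor_route x y : x \in S -> y \in S -> x != y -> #|odd3 x y| < 16 * 1000 * (t * t) ->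
  contains_totally_odd_immersion G (complete_graph t).
Proof.
move=> xS yS nxy poor.
pose cl (a b : bool) := [set p in S :\ x :\ y | (par x p == a) && (par p y == b)].
(* Four classes cover 2000 t - 2 vertices, so one has at least 499 t. *)
have [a [b cP]] : exists a b, 499 * t <= #|cl a b|.
  have cS0 : 2000 * t <= #|S :\ x :\ y| + 2.
    by rewrite -cS (cardsD1 x) xS (cardsD1 y (S :\ x)) !inE eq_sym nxy yS; clear; lia.
  have : #|S :\ x :\ y| <= #|cl true true| + #|cl true false| +
      (#|cl false true| + #|cl false false|).
    apply: leq_trans (_ : #|(cl true true :|: cl true false) :|: (cl false true :|: cl false false)| <= _).
      apply/subset_leq_card/subsetP=> p; rewrite !inE => ->.
      by case: (par x p); case: (par p y).
    by apply: leq_trans (leq_card_setU _ _) _; apply: leq_add; apply: leq_card_setU.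
  case: (leqP (499 * t) #|cl true true|) => [|l1]; first by exists true, true.
  case: (leqP (499 * t) #|cl true false|) => [|l2]; first by exists true, false.
  case: (leqP (499 * t) #|cl false true|) => [|l3]; first by exists false, true.
  case: (leqP (499 * t) #|cl false false|) => [|l4]; first by exists false, false.
  by move: l1 l2 l3 l4 cS0 t0; clear; lia.
set P := cl a b in cP; pose k := a (+) b.
have PP p : p \in P -> [/\ p \in S :\ x :\ y, par x p = a & par p y = b].
  by rewrite inE => /and3P[-> /eqP-> /eqP->].
have PS p : p \in P -> p \in S by move=> /PP[]; rewrite !inE => /and3P[].
pose bad := [set f : V * V | [&& f.1 \in P, f.2 \in P, f.1 != f.2 & par f.1 f.2 != k]].
have cbad : #|bad| < 16 * 1000 * (t * t).
  apply: leq_ltn_trans poor; apply/subset_leq_card/subsetP=> f; rewrite in_set => /and4P[f1 f2 nf kf].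
  have [e1 p1 q1] := PP _ f1; have [e2 p2 q2] := PP _ f2.
  rewrite in_set e1 e2 nf p1 q2 /=; move: kf; rewrite /k.
  by case: (a); case: (b); case: (par _ _).
pose row r := [set q in P | (q != r) && (par r q != k)].
pose col r := [set q in P | (q != r) && (par q r != k)].
have srow : \sum_(r in P) #|row r| <= #|bad|.
  rewrite sum_card_sections; apply/subset_leq_card/subsetP=> f.
  by rewrite !in_set => /andP[f1 /and3P[f2 nf kf]]; rewrite f1 f2 eq_sym nf kf.
have scol : \sum_(r in P) #|col r| <= #|bad|.
  rewrite sum_card_sections -(@card_imset _ _ (fun f : V * V => (f.2, f.1))); last first.
    by move=> [u v] [u' v'] [-> ->].
  apply/subset_leq_card/subsetP=> _ /imsetP[f fc ->]; move: fc.
  by rewrite !in_set /= => /andP[f1 /and3P[f2 nf kf]]; rewrite f1 f2 nf kf.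
(* Rows and columns contain fewer than 32000 t^2 pairs in all, so fewer than 320 t vertices of [P]
   fail to be good. *)
pose good := [set r in P | #|row r| + #|col r| < 100 * t].
have cgood : t <= #|good|.
  have : #|P :\: good| * (100 * t) <= \sum_(r in P) (#|row r| + #|col r|).
    rewrite (big_setID good) /= -sum_nat_const; apply: leq_trans (leq_addl _ _).
    by apply: leq_sum => r /setDP[rP]; rewrite inE rP /= -leqNgt.
  have := cardsID good P; rewrite big_split /= (setIidPr _); last by apply/subsetP=> p; rewrite inE => /andP[].
  move: srow scol cbad cP t0; clear; nia.
have [r [r_inj rG]] := injection_into cgood.
have rP i : r i \in P by have := rG i; rewrite inE => /andP[].
have rS i : r i \in S by apply: PS.
have rbad i : #|row (r i)| + #|col (r i)| < 100 * t by have := rG i; rewrite inE => /andP[].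
set R := r @: setT; pose P0 := P :\: R.
have cR : #|R| = t by rewrite card_imset // cardsT card_ord.
have cP0 : 498 * t <= #|P0|.
  have := cardsID R P; have : #|P :&: R| <= t by rewrite -cR subset_leq_card ?subsetIr.
  by rewrite -/P0; move: cP; clear; lia.
have P0P p : p \in P0 -> p \in P by case/setDP.
have P0S p : p \in P0 -> p \in S :\: r @: setT.
  by case/setDP=> /PS pS pR; rewrite in_setD pR.
have P0r p i : p \in P0 -> p != r i.
  by case/setDP=> _; apply: contraNneq => ->; apply: imset_f; rewrite inE.
have rowP i p : p \in P0 -> p \notin row (r i) -> par (r i) p = k.
  by move=> pP; rewrite inE P0P // P0r //= negbK => /eqP.
have colP i p : p \in P0 -> p \notin col (r i) -> par p (r i) = k.
  by move=> pP; rewrite inE P0P // P0r //= negbK => /eqP.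
(* If [k] is true, most trails inside [P] are odd, and three odd trails in a row have odd total
   length. *)
case Ek: k rowP colP => rowP colP.
  apply: (hub_route r_inj rS) => i j ij; set N := [set f | _].
  have le : #|setX P0 P0| <= #|N| + (#|[set (p, p) | p in P0]| + #|bad| +
      (#|setX (row (r i)) P0| + #|setX P0 (col (r j))|)).
    apply: leq_trans (_ : #|N :|: (([set (p, p) | p in P0] :|: bad) :|:
        (setX (row (r i)) P0 :|: setX P0 (col (r j))))| <= _); last first.
      do ![apply: leq_trans (leq_card_setU _ _) _; apply: leq_add => //].
    apply/subset_leq_card/subsetP=> -[p q]; rewrite in_setX => /andP[/= pP qP].
    rewrite !in_setU !in_setX pP qP /= andbT.
    have [pr|pr] := boolP (p \in row _); rewrite ?orbT //.
    have [qc|qc] := boolP (q \in col _); rewrite ?orbT //.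
    rewrite !orbF; have [->|npq] := eqVneq p q.
      by apply/orP; right; apply/orP; left; apply/imsetP; exists q.
    have [kb|nb] := boolP (par p q == true).
      by apply/orP; left; rewrite inE /= !P0S // npq (rowP i) // (colP j) // (eqP kb).
    by rewrite orbA; apply/orP; right; rewrite inE /= !P0P // npq Ek.
  have c1 : #|[set (p, p) | p in P0]| <= #|P0| by apply: leq_imset_card.
  have c2 := rbad i; have c3 := rbad j.
  move: le; rewrite !cardsX; move: c1 c2 c3 cbad cP0 t0; clear; nia.
(* If [k] is false, the outer trails are mostly even and the odd length comes from [odd_links]. Two
   disjoint sets of size 240 t fit into the 498 t vertices of [P0]. *)
have [P1 sP1 cP1] : exists2 P1 : {set V}, P1 \subset P0 & #|P1| = 240 * t.
  by apply: subset_of_size; move: cP0; clear; lia.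
have [P2 sP2 cP2] : exists2 P2 : {set V}, P2 \subset P0 :\: P1 & #|P2| = 240 * t.
  apply: subset_of_size; have := cardsID P1 P0; rewrite (setIidPr sP1) cP1.
  by move: cP0; clear; lia.
have sP2' : P2 \subset P0 by apply: subset_trans sP2 (subsetDl _ _).
have dis : [disjoint P1 & P2].
  by rewrite disjoint_sym; move: sP2; rewrite subsetD => /andP[].
have P0S' : P0 \subset S by apply/subsetP=> p /P0P/PS.
have [ltr [tgt [H1 H2 H3 H4]]] :=
  odd_links cutA cT clS (subset_trans sP1 P0S') (subset_trans sP2' P0S') dis.
have L1 f : f \in setX P1 P2 -> f.1 \in P0.
  by case: f => u v; rewrite in_setX => /andP[/(subsetP sP1)].
have L2 f : f \in setX P1 P2 -> f.2 \in P0.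
  by case: f => u v; rewrite in_setX => /andP[_ /(subsetP sP2')].
have L3 f : f \in setX P1 P2 -> tgt f \in P0.
  by move=> /H1[_ _ _ /(subsetP sP2')].
apply: (@route _ _ h T own S cT clS t r r_inj rS _ (setX P1 P2) fst tgt ltr
  id (240 * t)) (x, x).
- by move=> f /L1/P0P/PS.
- by move=> f i /L1/P0r.
- by move=> f /L3/P0P/PS.
- by move=> f i /L3/P0r.
- by move=> f /H1[].
- by move=> f /H1[].
- move=> f e i p fL ef pS npr.
  have hrp : h (r i) p by apply: clS; rewrite ?rS // eq_sym.
  have hpr : h p (r i) by apply: clS; rewrite ?rS.
  case: (H2 f fL e ef) => [ce|eT].
    split; apply/negP => eT; last by have := carrier_sub cT hpr eT; rewrite ce.
    by have := carrier_sub cT hrp eT; rewrite ce.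
  have hf : h f.1 f.2.
    apply: clS; [exact: PS (P0P _ (L1 f fL))|exact: PS (P0P _ (L2 f fL))|].
    apply: contraTneq fL => E; case: (f) E => u v /= ->; rewrite in_setX.
    by apply/negP => /andP[/(disjointFr dis) ->].
  have o1 := carrier_own cT hf eT.
  have nri : r i \notin [set f.1; f.2].
    by rewrite !inE negb_or !(eq_sym (r i)) !P0r ?L1 ?L2.
  split; apply: contra nri => eT'; rewrite -o1.
    by rewrite (carrier_own cT hrp eT') set21.
  by rewrite (carrier_own cT hpr eT') set22.
- by move=> f g e fL gL; apply: H3.
- move=> u; rewrite -cP2; apply: card_fst_eq => -[c d].
  by rewrite in_setX => /andP[].
- by move=> u; rewrite -cP1.
- move=> u; apply: (@leq_trans #|[set u]|); last by rewrite cards1.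
  by apply/subset_leq_card/subsetP=> f; rewrite !inE => /andP[].
move=> i j ij; set N := admissible _ _ _ _ _ _ _ _.
(* Of the 57600 t^2 links, fewer than 24000 t^2 are spoilt at each end, leaving more than the 962
   t^2 needed by [route]. *)
have le : #|setX P1 P2| <= #|N| + (#|setX (row (r i)) P2| +
    #|[set f in setX P1 P2 | tgt f \in col (r j)]|).
  apply: leq_trans (_ : #|N :|: (setX (row (r i)) P2 :|:
     [set f in setX P1 P2 | tgt f \in col (r j)])| <= _); last first.
    by do ![apply: leq_trans (leq_card_setU _ _) _; apply: leq_add => //].
  apply/subset_leq_card/subsetP=> f fL; rewrite !in_setU.
  have [tc|tc] := boolP (tgt f \in col (r j)); first by rewrite in_set fL tc !orbT.
  have [fr|fr] := boolP (f.1 \in row (r i)).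
    by apply/orP; right; apply/orP; left; case: (f) fL fr => u v; rewrite !in_setX => /andP[_ ->] ->.
  apply/orP; left; rewrite in_set fL !oddD /=.
  have [_ _ -> _] := H1 f fL.
  by rewrite (rowP i _ (L1 f fL) fr : odd _ = _) (colP j _ (L3 f fL) tc : odd _ = _).
have le2 : #|[set f in setX P1 P2 | tgt f \in col (r j)]| <= #|col (r j)| * (240 * t).
  rewrite -sum1_card (partition_big tgt (mem (col (r j)))) /=; last first.
    by move=> f; rewrite in_set => /andP[].
  rewrite -sum_nat_const; apply: leq_sum => u uc; rewrite sum1_card.
  apply: leq_trans (leq_trans (H4 u) (eq_leq cP1)).
  apply/subset_leq_card/subsetP=> f /andP[fm ft].
  by rewrite in_set ft andbT; move: fm; rewrite in_set => /andP[].
have := rbad i; have := rbad j.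
move: le le2; rewrite !cardsX cP1 cP2; move: t0; clear; nia.
Qed.
End Parity.

(** * Colouring *)

(** Greedy colouring: a vertex with at most [d] neighbours in [U] is coloured last. *)
Lemma degenerate_coloring (V : finType) (a : rel V) d (U : {set V}) : symmetric a -> irreflexive a ->
  (forall W : {set V}, W \subset U -> W != set0 -> exists2 x, x \in W & #|W :&: nbhd a x| < d.+1) ->
  exists c : V -> 'I_d.+1, {in U &, forall x y, a x y -> c x != c y}.
Proof.
move=> as_ ai; have [n] := ubnP #|U|; elim: n U => // n IH U; rewrite ltnS => le low.
have [->|U0] := eqVneq U set0; first by exists (fun _ => ord0) => x y; rewrite inE.
have [x xU degx] := low U (subxx U) U0.
have [||c cP] := IH (U :\ x).
- by move: le; rewrite (cardsD1 x U) xU.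
- by move=> W sW; apply: low; apply: subset_trans sW (subsetDl _ _).
have [k kP] : exists k : 'I_d.+1, k \notin c @: (U :&: nbhd a x).
  apply/existsP; rewrite -negb_forall; apply: contraL degx => /forallP all.
  rewrite -leqNgt -{1}(card_ord d.+1) -cardsT; apply: leq_trans (leq_imset_card c _).
  by apply/subset_leq_card/subsetP=> k _; apply: all.
have kc y : y \in U -> a x y -> k != c y.
  by move=> yU axy; apply: contraNneq kP => ->; apply: imset_f; rewrite !inE yU.
exists (fun y => if y == x then k else c y) => y z yU zU.
case: (eqVneq y x) => [->|ny]; case: (eqVneq z x) => [->|nz] ayz.
- by rewrite ai in ayz.
- exact: kc.
- by rewrite eq_sym; apply: kc; rewrite // as_.
- by apply: cP; rewrite // !inE ?ny ?nz.
Qed.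

(** * Colouring the two sides of a maximum cut *)

Section Main.
Variables (t : nat) (G : mgraph).
Hypotheses (t0 : 0 < t) (lG : loopless G).
Notation V := (vertex G).
Notation E := (edge G).

Definition adj : rel V := fun x y => [exists e, joins e x y].

Lemma joinsC (e : E) x y : joins e x y = joins e y x.
Proof. by rewrite /joins orbC. Qed.

Lemma adj_simple : simple_rel adj.
Proof.
split=> [x y|x]; first by apply: eq_existsb => e; rewrite joinsC.
by apply/negbTE/existsPn => e; apply: lG.
Qed.

(** All edges inside [W] belong to [X], since [W] lies on one side. One edge from each parallel
    class gives a simple graph dense enough for a clique on 2000 t vertices. *)
Lemma immersion_of_side (A W : {set V}) d :
  (forall S : {set V}, cut_size [set e | ~~ crosses e A] S <= cut_size [set e | crosses e A] S) ->
  {in W &, forall x y, (x \in A) = (y \in A)} -> W != set0 ->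
  (forall x, x \in W -> d <= #|W :&: nbhd adj x|) -> 150 * (2000 * t) + 2 < d ->
  ~ contains_totally_odd_immersion G (complete_graph t) -> False.
Proof.
move=> cutA side W0 deg big ncont; pose X := fun e => ~~ crosses e A.
pose a : rel V := fun x y => [&& x \in W, y \in W & adj x y].
have aS : simple_rel a.
  have [s1 i1] := adj_simple.
  by split=> [x y|x]; rewrite /a ?i1 ?andbF // s1 andbCA.
pose T x y : seq E := if [pick e | joins e x y] is Some e then [:: e] else [::].
have TP x y : a x y -> exists2 e, T x y = [:: e] & joins e x y.
  case/and3P=> _ _ /existsP[e0 j0]; rewrite /T; case: pickP => [e je|/(_ e0)]; first by exists e.
  by rewrite j0.
have aC : carried X a.
  exists T, (fun e => [set (ends e).1; (ends e).2]); split=> x y.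
  - by move=> /TP[e -> je]; exists y.
  - by move=> /TP[e -> _].
  - move=> e axy; have [f -> jf] := TP x y axy; rewrite inE => /eqP->.
    have /and3P[xW yW _] := axy.
    by rewrite /X (crosses_joins _ jf) (side x y) // addbb.
  - move=> e axy; have [f -> jf] := TP x y axy; rewrite inE => /eqP->.
    by move: jf; rewrite /joins => /orP[] /eqP-> //=; rewrite setUC.
have nW x : x \in W -> nbhd a x = W :&: nbhd adj x.
  by move=> xW; apply/setP=> y; rewrite !inE /a xW.
have aW : active a \subset W.
  apply/subsetP=> x; rewrite inE; apply: contraNT => xW.
  by apply/eqP/setP=> y; rewrite !inE /a (negPf xW).
have sumW : d * #|W| <= \sum_x #|nbhd a x|.
  rewrite [leqRHS](bigID (mem W)) /= mulnC -sum_nat_const; apply: leq_trans (leq_addr _ _).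
  by apply: leq_sum => x xW; rewrite nW // deg.
have cW : 0 < #|W| by rewrite card_gt0.
apply: (@dense_exists G X (2000 * t) a _ aS aC).
- by move: t0; clear; lia.
- apply: leq_trans _ sumW; apply: leq_ltn_trans (leq_mul (leqnn _) (subset_leq_card aW)) _.
  by rewrite ltn_mul2r cW.
move=> h hS hC; apply/negP => hD; apply: ncont.
have [|h' [S [[T' [own cT]] cS clS]]] := clique_of_dense _ hS hC hD.
  by rewrite muln_gt0 t0.
(* Either some pair has few odd paths of length three between its vertices, or all pairs have
   many. *)
case: (boolP [exists x in S, exists y in S,
    (x != y) && (#|odd3 T' S x y| < 16 * 1000 * (t * t))]).
  case/exists_inP=> x xS /exists_inP[y yS /andP[nxy lt]].
  exact: (poor_route cutA cT clS t0 cS xS yS nxy lt).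
move=> no; apply: (rich_route cT clS t0 cS) => x y xS yS nxy.
move: no; rewrite negb_exists_in => /forall_inP/(_ x xS).
rewrite negb_exists_in => /forall_inP/(_ y yS).
by rewrite nxy /= -leqNgt.
Qed.

Lemma side_coloring (A U : {set V}) d :
  (forall S : {set V}, cut_size [set e | ~~ crosses e A] S <= cut_size [set e | crosses e A] S) ->
  {in U &, forall x y, (x \in A) = (y \in A)} -> 150 * (2000 * t) + 2 <= d ->
  ~ contains_totally_odd_immersion G (complete_graph t) ->
  exists c : V -> 'I_d.+1, {in U &, forall x y, adj x y -> c x != c y}.
Proof.
move=> cutA side big ncont; have [as_ ai] := adj_simple.
apply: degenerate_coloring => // W sW W0.
have [/exists_inP//|no] := boolP [exists x in W, #|W :&: nbhd adj x| < d.+1].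
case: (@immersion_of_side A W d.+1 cutA _ W0 _ _ ncont) => //.
- by move=> x y xW yW; apply: side; apply: (subsetP sW).
- move=> x xW; move: no; rewrite negb_exists_in => /forall_inP/(_ x xW).
  by rewrite -leqNgt.
Qed.

End Main.

Theorem corollary1p2 (t : nat) (ht : 0 < t) (G : mgraph) :
  loopless G ->
  ~ contains_totally_odd_immersion G (complete_graph t) ->
  colorable (7 * 10 ^ 5 * t + 32 * 10 ^ 6) G.
Proof.
move=> lG ncont; have [A cutA] := max_cut_exists G.
(* Each side receives half of the colours, [d.+1] = 350000 t + 16000000. *)
have [d [dE big]] : exists d, 7 * 10 ^ 5 * t + 32 * 10 ^ 6 = d.+1 + d.+1 /\
    150 * (2000 * t) + 2 <= d.
  have -> : 10 ^ 6 = 100 * 10 ^ 4 by rewrite -(expnD 10 2 4).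
  have -> : 10 ^ 5 = 10 * 10 ^ 4 by rewrite -(expnD 10 1 4).
  have : 10 ^ 4 = 100 * 100 by rewrite -(expnD 10 2 2).
  move: (10 ^ 4) => X XE; exists (35 * X * t + (1600 * X).-1).
  by split; rewrite XE; clear; lia.
have [|c1 c1P] := side_coloring (U := A) ht lG cutA _ big ncont.
  by move=> x y -> ->.
have [|c2 c2P] := side_coloring (U := ~: A) ht lG cutA _ big ncont.
  by move=> x y; rewrite !inE => /negPf-> /negPf->.
(* The two sides use disjoint palettes, so edges across the cut are properly coloured. *)
rewrite dE; exists (fun x => if x \in A then lshift _ (c1 x) else rshift _ (c2 x)).
move=> x y [e jxy]; have axy : adj x y by apply/existsP; exists e.
case: (boolP (x \in A)) => xA; case: (boolP (y \in A)) => yA.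
- by move/lshift_inj => E; have := c1P x y xA yA axy; rewrite E eqxx.
- by move/(congr1 val) => /= E; have := ltn_ord (c1 x); rewrite E ltnNge leq_addr.
- by move/(congr1 val) => /= E; have := ltn_ord (c1 y); rewrite -E ltnNge leq_addr.
- move/rshift_inj => E; have := c2P x y; rewrite !inE xA yA => /(_ isT isT axy).
  by rewrite E eqxx.
Qed.
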